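(* Let $\mathcal Q$ be a connected poset, $G\colon \mathcal Q\to \mathrm{InjGroups}$ a simple complex of groups, $\hat G=\operatorname{colim}_{\mathcal Q}G$, and let $\varphi\colon \hat G\to K$ be a group homomorphism whose restriction to $G(q)$ is injective for every $q\in\mathcal Q$. Let $\mathcal P$ be the associated $K$-poset. Then there is a functor $F\colon \mathcal Q\to \mathrm{Cat}$, taking values in small categories with $K$-action and $K$-equivariant functors, such that $$|\mathcal P|\simeq \operatorname{hocolim}_{\mathcal Q}|F|,\qquad |F(q)|\simeq K/G(q)\ \text{ for every } q\in\mathcal Q .$$ Moreover, there is a fibration $$|\mathcal P|\to |\mathcal P|_{hK}\to BK,$$ where $|\mathcal P|_{hK}\simeq \operatorname{hocolim}_{q\in\mathcal Q} EK\times_K |F(q)|$, and $EK\times_K |F(q)|\simeq BG(q)$ for every $q\in\mathcal Q$.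
   Context: Posets are regarded as categories with a unique morphism $p\to q$ iff $p\le q$; $|\cdot|$ denotes geometric realization (of the nerve), and $\mathrm{Cat}$ is the category of small categories. $\mathrm{InjGroups}$ is the category of groups and injective homomorphisms; a simple complex of groups over a connected poset $\mathcal Q$ is a functor $G\colon\mathcal Q\to\mathrm{InjGroups}$. The colimit $\hat G$ is taken in the category of groups, with canonical maps $\iota_q\colon G(q)\to \hat G$; ''the restriction of $\varphi$ to $G(q)$'' means $\varphi\circ\iota_q$, and $G(q)$ is identified with its image $\varphi(\iota_q(G(q)))\subseteq K$. The associated $K$-poset is $\mathcal P=\bigsqcup_{q\in\mathcal Q}K/G(q)$, with elements $(kG(q),q)$, strict order $(kG(q),q)<(k'G(r),r)$ iff $q<r$ and $k^{-1}k'\in G(r)$, and $K$-action $k\cdot(gG(q),q)=(kgG(q),q)$. For a $K$-space $X$, $X_{hK}=EK\times_K X$ is the Borel construction. $K$ is a discrete group and $K/G(q)$ is a discrete space. *)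

(* Defs.v *)
From HB Require Import structures.
From Stdlib Require Import Relation_Operators.
From mathcomp Require Import all_boot all_order all_algebra generic_quotient.
From mathcomp Require Import all_classical all_reals all_analysis.
Import Order.TTheory GRing.Theory Num.Theory.
Import numFieldNormedType.Exports.

Set Implicit Arguments.
Unset Strict Implicit.
Unset Printing Implicit Defensive.

Local Open Scope classical_set_scope.
Local Open Scope ring_scope.

Record category := Category {
  cobj :> Type;
  chom : cobj -> cobj -> Type;
  cid : forall x, chom x x;
  ccomp : forall x y z, chom y z -> chom x y -> chom x z;
  ccompA : forall x y z t (h : chom z t) (g : chom y z) (f : chom x y),
    ccomp h (ccomp g f) = ccomp (ccomp h g) f;
  ccomp1f : forall x y (f : chom x y), ccomp (cid y) f = f;
  ccompf1 : forall x y (f : chom x y), ccomp f (cid x) = f }.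

Record functor (C D : category) := Functor {
  fobj :> C -> D;
  fmap : forall x y, chom x y -> chom (fobj x) (fobj y);
  fmap1 : forall x, fmap (cid x) = cid (fobj x);
  fmapM : forall x y z (g : chom y z) (f : chom x y),
    fmap (ccomp g f) = ccomp (fmap g) (fmap f) }.

Lemma functor_eq C D (F G : functor C D) (e : fobj F = fobj G) :
  (forall x y (f : chom x y),
     eq_rect _ (fun o => chom (o x) (o y)) (fmap F f) _ e = fmap G f) ->
  F = G.
Proof.
case: F G e => fo fm f1 fM [go gm g1 gM] /= e; case: _ / e gm g1 gM => /=.
move=> gm g1 gM fgm; have e : fm = gm.
  apply: functional_extensionality_dep => x.
  apply: functional_extensionality_dep => y.
  by apply: functional_extensionality_dep => f; apply: fgm.
case: _ / e g1 gM {fgm} => g1 gM.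
by rewrite (Prop_irrelevance f1 g1) (Prop_irrelevance fM gM).
Qed.

Definition functor_id (C : category) : functor C C :=
  @Functor C C id (fun _ _ f => f) (fun _ => erefl) (fun _ _ _ _ _ => erefl).

Definition functor_comp (C D E : category) (G : functor D E) (F : functor C D) :
  functor C E.
Proof.
refine (@Functor C E (G \o F) (fun _ _ f => fmap G (fmap F f)) _ _).
- by move=> x; rewrite !fmap1.
- by move=> x y z g f; rewrite !fmapM.
Defined.

Lemma functor_compA (B C D E : category)
    (H : functor D E) (G : functor C D) (F : functor B C) :
  functor_comp H (functor_comp G F) = functor_comp (functor_comp H G) F.
Proof. exact: functor_eq. Qed.

Lemma functor_comp1f (C D : category) (F : functor C D) :
  functor_comp (functor_id D) F = F.
Proof. exact: functor_eq. Qed.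

Definition poset_cat d (P : porderType d) : category.
Proof.
refine (@Category P (fun x y => (x <= y)%O) (fun x => lexx x)
  (fun x y z yz xy => le_trans xy yz) _ _ _);
by move=> *; exact: bool_irrelevance.
Defined.

Definition poset_functor d d' (P : porderType d) (P' : porderType d')
  (f : {omorphism P -> P'}) : functor (poset_cat P) (poset_cat P').
Proof.
refine (@Functor (poset_cat P) (poset_cat P') f
  (fun x y xy => omorph_le f xy) _ _); by move=> *; exact: bool_irrelevance.
Defined.

Lemma poset_functor_eq (C : category) d (P : porderType d)
  (F G : functor C (poset_cat P)) : fobj F =1 fobj G -> F = G.
Proof.
move=> /funext e; apply: (functor_eq (e := e)) => x y f.
exact: bool_irrelevance.
Qed.

Definition indiscrete_cat (T : Type) : category.
Proof.
refine (@Category T (fun _ _ => unit) (fun _ => tt) (fun _ _ _ _ _ => tt) _ _ _).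
- by [].
- by move=> x y [].
- by move=> x y [].
Defined.

Definition indiscrete_functor (T U : Type) (f : T -> U) :
  functor (indiscrete_cat T) (indiscrete_cat U) :=
  @Functor (indiscrete_cat T) (indiscrete_cat U) f (fun _ _ _ => tt)
    (fun _ => erefl) (fun _ _ _ _ _ => erefl).

Lemma indiscrete_functor_eq (C : category) (T : Type)
  (F G : functor C (indiscrete_cat T)) : fobj F =1 fobj G -> F = G.
Proof.
move=> /funext e; apply: (functor_eq (e := e)) => x y f.
by move: (eq_rect _ _ _ _ _) (fmap G f) => [] [].
Qed.

Record sset := SSet {
  simplices :> nat -> Type;
  sop : forall m n, {omorphism 'I_m.+1 -> 'I_n.+1} -> simplices n -> simplices m;
  sop1 : forall n (x : simplices n), sop idfun x = x;
  sopM : forall l m n (t : {omorphism 'I_m.+1 -> 'I_n.+1})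
    (u : {omorphism 'I_l.+1 -> 'I_m.+1}) (x : simplices n),
    sop (t \o u) x = sop u (sop t x) }.

Record smap (X Y : sset) := SMap {
  smap_fun :> forall n, X n -> Y n;
  smap_nat : forall m n (t : {omorphism 'I_m.+1 -> 'I_n.+1}) (x : X n),
    smap_fun (sop t x) = sop t (smap_fun x) }.

(** An [n]-simplex of the nerve is a functor from the ordinal [0 < ... < n]. *)
Definition nerve (C : category) : sset.
Proof.
refine (@SSet (fun n => functor (poset_cat 'I_n.+1) C)
  (fun m n t x => functor_comp x (poset_functor t)) _ _).
- move=> n x; apply: functor_eq => i j ij /=.
  by congr (fmap x _); exact: bool_irrelevance.
- move=> l m n t u x; apply: functor_eq => i j ij /=.
  by congr (fmap x _); exact: bool_irrelevance.
Defined.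

Definition nerve_map (C D : category) (F : functor C D) :
  smap (nerve C) (nerve D).
Proof.
refine (@SMap (nerve C) (nerve D) (fun n x => functor_comp F x) _).
by move=> m n t x; exact: functor_compA.
Defined.

Section Identify.
Local Open Scope quotient_scope.
Context (T : topologicalType) (r : T -> T -> Prop).

Definition glue_eq : rel T := fun x y => `[< clos_refl_sym_trans T r x y >].

Fact glue_eq_refl : reflexive glue_eq.
Proof. by move=> x; apply/asboolP; exact: rst_refl. Qed.

Fact glue_eq_sym : symmetric glue_eq.
Proof.
by move=> x y; apply/idP/idP => /asboolP xy; apply/asboolP; exact: rst_sym.
Qed.

Fact glue_eq_trans : transitive glue_eq.
Proof.
move=> y x z /asboolP xy /asboolP yz; apply/asboolP.
exact: rst_trans xy yz.
Qed.

Canonical glue_equiv := EquivRel glue_eq glue_eq_refl glue_eq_sym glue_eq_trans.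

Definition identify : topologicalType :=
  quotient_topology {eq_quot glue_equiv}.

Definition ipi (x : T) : identify := \pi_{eq_quot glue_equiv} x.

Lemma ipi_continuous : continuous ipi.
Proof. exact: (@pi_continuous T {eq_quot glue_equiv}). Qed.

Lemma ipi_surj (q : identify) : exists x, ipi x = q.
Proof.
by exists (repr (q : {eq_quot glue_equiv})); rewrite /ipi reprK.
Qed.

Lemma ipi_eq x y : r x y -> ipi x = ipi y.
Proof. by move=> xy; apply/eqmodP/asboolP; exact: rst_step. Qed.

Definition ilift (Z : Type) (f : T -> Z) (q : identify) : Z :=
  f (repr (q : {eq_quot glue_equiv})).

Lemma iliftE (Z : Type) (f : T -> Z) :
  (forall x y, r x y -> f x = f y) -> forall x, ilift f (ipi x) = f x.
Proof.
move=> rf x; rewrite /ilift /ipi; case: piP => y /eqmodP /asboolP.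
elim=> {x y} [x y /rf //|//|x y _ -> //|x y z _ -> _ -> //].
Qed.

Lemma ilift_continuous (Z : topologicalType) (f : T -> Z) :
  (forall x y, r x y -> f x = f y) -> continuous f -> continuous (ilift f).
Proof.
move=> rf cf.
apply/(@quotient_continuous T {eq_quot glue_equiv} Z (ilift f)).
by rewrite (_ : _ \o _ = f) //; apply/funext => x; exact: iliftE.
Qed.
End Identify.

Section Realization.
Variable R : realType.

Definition simplex n : set 'rV[R]_n.+1 :=
  [set s | (forall i, 0 <= s ord0 i) /\ \sum_i s ord0 i = 1].
Arguments simplex : clear implicits.

Definition simplex_push m n (t : 'I_m.+1 -> 'I_n.+1) (s : simplex m) :
  simplex n.
Proof.
exists (\row_j \sum_(i | t i == j) (\val s) ord0 i).
apply/mem_set; have [s0 s1] := set_mem (valP s); split=> [j|].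
  by rewrite mxE; apply: sumr_ge0.
rewrite -[RHS]s1 [RHS](partition_big t xpredT) //=.
by apply: eq_bigr => j _; rewrite mxE.
Defined.

Section Defs.
Variable X : sset.

Definition prerealization : topologicalType :=
  {x : {classic {n & X n}} & simplex (projT1 x)}.

Definition cell n (x : X n) (s : simplex n) : prerealization :=
  @existT {classic {n & X n}} (fun x => simplex (projT1 x)) (existT _ n x) s.

Inductive realization_rel : prerealization -> prerealization -> Prop :=
  RealizationRel m n (t : {omorphism 'I_m.+1 -> 'I_n.+1}) (x : X n)
      (s : simplex m) :
    realization_rel (cell (sop t x) s) (cell x (simplex_push t s)).

Definition realization : topologicalType := identify realization_rel.
End Defs.

Section Map.
Variables (X Y : sset) (f : smap X Y).

Definition prerealization_map (x : prerealization X) : prerealization Y :=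
  cell (f _ (projT2 (projT1 x))) (projT2 x).

Lemma prerealization_map_continuous : continuous prerealization_map.
Proof.
move=> [i s]; apply: (@sigT_continuous {classic {n & X n}}
  (fun x => simplex (projT1 x)) _ (fun i s => cell (f _ (projT2 i)) s)) => j.
exact: (@existT_continuous {classic {n & Y n}}
  (fun x => simplex (projT1 x)) (existT _ (projT1 j) (f _ (projT2 j)))).
Qed.

Definition realization_map : realization X -> realization Y :=
  ilift (fun x => ipi (@realization_rel Y) (prerealization_map x)).

Fact realization_map_rel x y : realization_rel x y ->
  ipi (@realization_rel Y) (prerealization_map x) =
  ipi (@realization_rel Y) (prerealization_map y).
Proof.
case=> m n t {}x s; apply: ipi_eq; rewrite /prerealization_map/= smap_nat.
exact: RealizationRel.
Qed.

Lemma realization_mapE x :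
  realization_map (ipi (@realization_rel X) x) = ipi _ (prerealization_map x).
Proof. exact: (iliftE realization_map_rel). Qed.

Lemma realization_map_continuous : continuous realization_map.
Proof.
apply: (ilift_continuous realization_map_rel) => x.
apply: continuous_comp; first exact: prerealization_map_continuous.
exact: ipi_continuous.
Qed.
End Map.

Definition realize (C : category) : topologicalType := realization (nerve C).

Definition realize_map (C D : category) (F : functor C D) :
  realize C -> realize D := realization_map (nerve_map F).

Lemma realize_map1 (C : category) : realize_map (functor_id C) =1 id.
Proof.
move=> q; have [[[n x] s] <-] := ipi_surj q.
rewrite /realize_map realization_mapE /prerealization_map/=.
by rewrite functor_comp1f.
Qed.

Lemma realize_mapM (C D E : category) (G : functor D E) (F : functor C D) :
  realize_map (functor_comp G F) =1 realize_map G \o realize_map F.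
Proof.
move=> q; have [[[n x] s] <-] := ipi_surj q.
rewrite /realize_map /= !realization_mapE /prerealization_map/=.
by rewrite functor_compA.
Qed.

Lemma realize_map_continuous (C D : category) (F : functor C D) :
  continuous (realize_map F).
Proof. exact: realization_map_continuous. Qed.

End Realization.
Arguments simplex : clear implicits.

Record Kspace (K : groupType) := KSpace {
  kspace :> topologicalType;
  kact : K -> kspace -> kspace;
  kact_continuous : forall k, continuous (kact k);
  kact1 : forall x, kact 1%g x = x;
  kactM : forall a b x, kact (a * b)%g x = kact a (kact b x) }.

Record Kmap (K : groupType) (X Y : Kspace K) := KMap {
  kmap :> X -> Y;
  kmap_continuous : continuous kmap;
  kmap_act : forall k x, kmap (kact k x) = kact k (kmap x) }.

Section Orbits.
Variable K : groupType.

Definition orbit_rel (X : Kspace K) (x y : X) : Prop :=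
  exists k, y = kact k x.

Definition orbit_space (X : Kspace K) : topologicalType :=
  identify (@orbit_rel X).

Definition orbit_pi (X : Kspace K) : X -> orbit_space X := @ipi X (@orbit_rel X).

Definition orbit_map (X Y : Kspace K) (f : Kmap X Y) :
  orbit_space X -> orbit_space Y := ilift (orbit_pi (X := Y) \o f).

Fact orbit_map_rel (X Y : Kspace K) (f : Kmap X Y) x y : orbit_rel x y ->
  (orbit_pi (X := Y) \o f) x = (orbit_pi (X := Y) \o f) y.
Proof.
by case=> k ->; apply: ipi_eq; exists k; rewrite kmap_act.
Qed.

Lemma orbit_mapE (X Y : Kspace K) (f : Kmap X Y) x :
  orbit_map f (orbit_pi x) = orbit_pi (f x).
Proof. exact: (iliftE (orbit_map_rel f)). Qed.

Lemma orbit_map_continuous (X Y : Kspace K) (f : Kmap X Y) :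
  continuous (orbit_map f).
Proof.
apply: (ilift_continuous (orbit_map_rel f)) => x.
apply: continuous_comp; first exact: kmap_continuous.
exact: ipi_continuous.
Qed.

Lemma orbit_map1 (X : Kspace K) (f : Kmap X X) : f =1 id -> orbit_map f =1 id.
Proof.
move=> f1 q; have [x <-] := ipi_surj q.
by rewrite -/(orbit_pi x) orbit_mapE f1.
Qed.

Lemma orbit_mapM (X Y Z : Kspace K) (h : Kmap X Z) (g : Kmap Y Z)
    (f : Kmap X Y) :
  h =1 g \o f -> orbit_map h =1 orbit_map g \o orbit_map f.
Proof.
move=> hgf q; have [x <-] := ipi_surj q.
by rewrite -/(orbit_pi x) /= !orbit_mapE hgf.
Qed.

Lemma pair_continuous (X Y X' Y' : topologicalType) (f : X -> X')
    (g : Y -> Y') : continuous f -> continuous g ->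
  continuous (fun z : X * Y => (f z.1, g z.2)).
Proof.
move=> cf cg [x y]; apply: cvg_pair => /=.
- by apply: cvg_comp; [exact: cvg_fst|exact: cf].
- by apply: cvg_comp; [exact: cvg_snd|exact: cg].
Qed.

Definition prod_Kspace (X Y : Kspace K) : Kspace K.
Proof.
refine (@KSpace K (X * Y)%type (fun k z => (kact k z.1, kact k z.2)) _ _ _).
- by move=> k; apply: pair_continuous; exact: kact_continuous.
- by move=> [x y]; rewrite !kact1.
- by move=> a b [x y]; rewrite /= !kactM.
Defined.

Definition fst_Kmap (X Y : Kspace K) : Kmap (prod_Kspace X Y) X.
Proof.
refine (@KMap K (prod_Kspace X Y) X fst _ _); last by [].
by move=> [x y]; exact: cvg_fst.
Defined.

Definition prod_Kmap (X Y Z : Kspace K) (f : Kmap Y Z) :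
  Kmap (prod_Kspace X Y) (prod_Kspace X Z).
Proof.
refine (@KMap K (prod_Kspace X Y) (prod_Kspace X Z) (fun z => (z.1, f z.2)) _ _).
- apply: (@pair_continuous X Y X Z id f); first by move=> ?; exact: cvg_id.
  exact: kmap_continuous.
- by move=> k [x y]; rewrite /= kmap_act.
Defined.
End Orbits.

Record Kcat (K : groupType) := KCat {
  kcat :> category;
  kcact : K -> functor kcat kcat;
  kcact1 : kcact 1%g = functor_id kcat;
  kcactM : forall a b, kcact (a * b)%g = functor_comp (kcact a) (kcact b) }.

Record Kfunctor (K : groupType) (C D : Kcat K) := KFunctor {
  kfunctor :> functor C D;
  kfunctor_act : forall k,
    functor_comp kfunctor (kcact C k) = functor_comp (kcact D k) kfunctor }.

Section RealizeK.
Variables (R : realType) (K : groupType).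

Definition realizeK (C : Kcat K) : Kspace K.
Proof.
refine (@KSpace K (realize R C) (fun k => realize_map (kcact C k)) _ _ _).
- by move=> k; exact: realize_map_continuous.
- by move=> x; rewrite kcact1 realize_map1.
- by move=> a b x; rewrite kcactM realize_mapM.
Defined.

Definition realizeK_map (C D : Kcat K) (F : Kfunctor C D) :
  Kmap (realizeK C) (realizeK D).
Proof.
refine (@KMap K (realizeK C) (realizeK D) (realize_map (R := R) F) _ _).
- exact: realize_map_continuous.
- move=> k x; rewrite /kact/=.
  by have := realize_mapM F (kcact C k) x; rewrite kfunctor_act realize_mapM.
Defined.
End RealizeK.

Section Borel.
Variables (R : realType) (K : groupType).

(** The action groupoid of [K] acting on itself; its realization [EG] is the
    total space of the bar construction. *)
Definition translation_cat : Kcat K.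
Proof.
refine (@KCat K (indiscrete_cat K)
  (fun k => indiscrete_functor (fun x : K => (k * x)%g)) _ _).
- by apply: indiscrete_functor_eq => x; exact: mul1g.
- by move=> a b; apply: indiscrete_functor_eq => x; rewrite /= mulgA.
Defined.

Definition EG : Kspace K := realizeK R translation_cat.

Definition BG : topologicalType := orbit_space EG.

(** [X_hK = EK *_K X]; [EK * X] carries the product topology, and both actions
    are left actions. *)
Definition borel (X : Kspace K) : topologicalType :=
  orbit_space (prod_Kspace EG X).

Definition borel_map (X Y : Kspace K) (f : Kmap X Y) : borel X -> borel Y :=
  orbit_map (prod_Kmap EG f).

Definition borel_proj (X : Kspace K) : borel X -> BG :=
  orbit_map (fst_Kmap EG X).

Definition borel_incl (X : Kspace K) (e : EG) (x : X) : borel X :=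
  orbit_pi (X := prod_Kspace EG X) (e, x).
End Borel.

Section Homotopy.
Variable R : realType.

Definition unit_interval : set R := `[0, 1]%classic.

Definition homotopic (X Y : topologicalType) (f g : X -> Y) : Prop :=
  exists H : X * unit_interval -> Y,
    [/\ continuous H,
        forall x t, \val t = 0 -> H (x, t) = f x &
        forall x t, \val t = 1 -> H (x, t) = g x].

Definition homotopy_equivalent (X Y : topologicalType) : Prop :=
  exists (f : X -> Y) (g : Y -> X),
    [/\ continuous f, continuous g, homotopic (g \o f) id & homotopic (f \o g) id].

(** Hurewicz fibrations. *)
Definition fibration (E B : topologicalType) (p : E -> B) : Prop :=
  continuous p /\
  forall (Y : topologicalType) (f : Y -> E) (H : Y * unit_interval -> B),
    continuous f -> continuous H ->
    (forall y t, \val t = 0 -> H (y, t) = p (f y)) ->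
    exists L : Y * unit_interval -> E,
      [/\ continuous L,
          forall y t, \val t = 0 -> L (y, t) = f y &
          forall z, p (L z) = H z].

(** The conditions on [i] say that it is a homeomorphism from [F] onto the fibre
    of [p] over [b]. *)
Definition fibration_sequence (F E B : topologicalType)
    (i : F -> E) (p : E -> B) (b : B) : Prop :=
  [/\ fibration p, continuous i, injective i, range i = p @^-1` [set b] &
      forall U : set F, open U -> exists2 V : set E, open V & U = i @^-1` V].
End Homotopy.

Section Diagrams.
Context d (Q : porderType d).

Record diagram := Diagram {
  dobj :> Q -> topologicalType;
  dmap : forall p q, (p <= q)%O -> dobj p -> dobj q;
  dmap_continuous : forall p q (pq : (p <= q)%O), continuous (dmap pq);
  dmap1 : forall p (pp : (p <= p)%O) x, dmap pp x = x;
  dmapM : forall p q r (pq : (p <= q)%O) (qr : (q <= r)%O) (pr : (p <= r)%O) x,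
    dmap pr x = dmap qr (dmap pq x) }.

Record Kcat_diagram (K : groupType) := KcatDiagram {
  kdobj :> Q -> Kcat K;
  kdmap : forall p q, (p <= q)%O -> Kfunctor (kdobj p) (kdobj q);
  kdmap1 : forall p (pp : (p <= p)%O),
    kdmap pp = functor_id (kdobj p) :> functor _ _;
  kdmapM : forall p q r (pq : (p <= q)%O) (qr : (q <= r)%O) (pr : (p <= r)%O),
    kdmap pr = functor_comp (kdmap qr) (kdmap pq) :> functor _ _ }.

Section DiagramOps.
Variables (R : realType) (K : groupType) (F : Kcat_diagram K).

Definition realize_diagram : diagram.
Proof.
refine (@Diagram (fun q => realize R (F q))
  (fun p q pq => realize_map (kdmap F pq)) _ _ _).
- by move=> p q pq; exact: realize_map_continuous.
- by move=> p pp x; rewrite kdmap1 realize_map1.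
- by move=> p q r pq qr pr x; rewrite (kdmapM _ pq qr) realize_mapM.
Defined.

Definition borel_diagram : diagram.
Proof.
refine (@Diagram (fun q => borel R (realizeK R (F q)))
  (fun p q pq => borel_map (realizeK_map R (kdmap F pq))) _ _ _).
- by move=> p q pq; exact: orbit_map_continuous.
- move=> p pp; apply: orbit_map1 => -[e y].
  by rewrite /= kdmap1 realize_map1.
- move=> p q r pq qr pr; apply: orbit_mapM => -[e y].
  by rewrite /= (kdmapM _ pq qr) realize_mapM.
Defined.
End DiagramOps.

Section Hocolim.
Variables (R : realType) (X : diagram).

Lemma chain_head n (c : nerve (poset_cat Q) n) (i : 'I_n.+1) :
  (c ord0 <= c i)%O.
Proof.
exact: (fmap c (leq0n i : @chom (poset_cat 'I_n.+1) ord0 i)).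
Qed.

(** The realization of the simplicial space whose [n]-th space is the disjoint
    union, over the chains [q0 <= ... <= qn] of [Q], of the spaces [X q0]
    (Bousfield-Kan). *)
Definition prehocolim : topologicalType :=
  {c : {classic {n & nerve (poset_cat Q) n}} &
    (X (projT2 c ord0) * simplex R (projT1 c))%type}.

Definition hocell n (c : nerve (poset_cat Q) n) (x : X (c ord0))
    (s : simplex R n) : prehocolim :=
  @existT {classic {n & nerve (poset_cat Q) n}}
    (fun c => X (projT2 c ord0) * simplex R (projT1 c))%type
    (existT _ n c) (x, s).

(** A face or degeneracy [t] sends the chain [c] to [c \o t], whose least element
    is [c (t 0) >= c 0]. *)
Inductive hocolim_rel : prehocolim -> prehocolim -> Prop :=
  HocolimRel m n (t : {omorphism 'I_m.+1 -> 'I_n.+1})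
      (c : nerve (poset_cat Q) n) (x : X (c ord0)) (s : simplex R m) :
    hocolim_rel
      (hocell (c := sop t c)
         (@dmap X (c ord0) (c (t ord0)) (chain_head c (t ord0)) x) s)
      (hocell x (simplex_push t s)).

Definition hocolim : topologicalType := identify hocolim_rel.
End Hocolim.
End Diagrams.

Lemma mulmorph1 (G H : groupType) (f : {multiplicative G -> H}) : f 1%g = 1%g.
Proof. by apply: (mulgI (f 1%g)); rewrite -gmulfM !mulg1. Qed.

Section Complexes.
Context d (Q : porderType d).

Definition connected_poset : Prop :=
  (exists q : Q, True) /\
  forall p q : Q, clos_refl_sym_trans Q (fun x y => (x <= y)%O) p q.

Record complex_of_groups := ComplexOfGroups {
  cg :> Q -> groupType;
  cg_map : forall p q, (p <= q)%O -> {multiplicative cg p -> cg q};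
  cg_inj : forall p q (pq : (p <= q)%O), injective (cg_map pq);
  cg_map1 : forall p (pp : (p <= p)%O) x, cg_map pp x = x;
  cg_mapM : forall p q r (pq : (p <= q)%O) (qr : (q <= r)%O) (pr : (p <= r)%O) x,
    cg_map pr x = cg_map qr (cg_map pq x) }.

Variable G : complex_of_groups.

Record cocone (H : groupType) := Cocone {
  leg :> forall q, {multiplicative G q -> H};
  leg_map : forall p q (pq : (p <= q)%O) x, leg q (cg_map G pq x) = leg p x }.

Definition cocone_comp (H K : groupType) (phi : {multiplicative H -> K})
  (c : cocone H) : cocone K.
Proof.
refine (@Cocone K (fun q => phi \o c q) _).
by move=> p q pq x /=; rewrite leg_map.
Defined.

Definition is_colimit (H : groupType) (c : cocone H) : Prop :=
  forall (H' : groupType) (c' : cocone H'),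
    exists u : {multiplicative H -> H'},
      (forall q x, u (c q x) = c' q x) /\
      forall v : {multiplicative H -> H'},
        (forall q x, v (c q x) = c' q x) -> v =1 u.
End Complexes.

Section CosetPoset.
Context d (Q : porderType d) (G : complex_of_groups Q) (K : groupType).
Variable c : cocone G K.

Definition lcoset (k : K) (q : Q) : set K := [set (k * h)%g | h in range (c q)].

(** [K / G(q)], where [G(q)] is identified with its image in [K]. *)
Definition cosets (q : Q) : set (set K) := range (lcoset^~ q).

Lemma lcoset_mem k q : lcoset k q \in cosets q.
Proof. by apply/mem_set; exists k. Qed.

Definition to_coset (k : K) (q : Q) : cosets q :=
  exist (fun A => A \in cosets q) _ (lcoset_mem k q).

Definition coset_poset : Type := {q : Q & cosets q}.

HB.instance Definition _ := Choice.on coset_poset.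

Definition coset_elt (k : K) (q : Q) : coset_poset := existT _ q (to_coset k q).

Definition coset_lt (x y : coset_poset) : bool :=
  `[< exists k q k' r, [/\ x = coset_elt k q, y = coset_elt k' r,
        (q < r)%O & range (c r) (k^-1 * k')%g] >].

Lemma coset_elt_ex (x : coset_poset) : exists k, x = coset_elt k (tag x).
Proof.
case: x => q [A Aq] /=; have [k _ kA] := set_mem Aq; exists k.
congr (existT _ q _); apply/val_inj; exact/esym.
Qed.

Lemma coset_elt_eq k k' q : coset_elt k q = coset_elt k' q ->
  range (c q) (k^-1 * k')%g.
Proof.
move=> /eqP; rewrite eq_Tagged /= => /eqP /(congr1 val) /= e.
have : lcoset k' q k'.
  by exists 1%g; [exists 1%g => //; exact: mulmorph1|rewrite mulg1].
by rewrite -e => -[h [g _ <-] <-]; exists g => //; rewrite mulKg.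
Qed.

Fact coset_lt_irr : irreflexive coset_lt.
Proof.
move=> x; apply/asboolP => -[k [q [k' [r [-> /(congr1 tag) /= <-]]]]].
by rewrite ltxx.
Qed.

Fact coset_lt_trans : transitive coset_lt.
Proof.
move=> y x z /asboolP[k1 [q [k2 [r [-> -> qr [g _ gE]]]]]].
move=> /asboolP[k3 [r' [k4 [s [e -> rs [g' _ g'E]]]]]]; apply/asboolP.
have er := congr1 tag e; rewrite /= in er; case: _ / er rs e => rs.
move=> /coset_elt_eq [h _ hE].
exists k1, q, k4, s; split=> //; first exact: lt_trans qr rs.
exists (cg_map G (ltW rs) (g * h) * g')%g => //.
rewrite gmulfM leg_map gmulfM gE hE g'E.
by rewrite !mulgA mulgK mulgK.
Qed.

HB.instance Definition _ :=
  Order.Lt_isPOrder.Build d coset_poset coset_lt_irr coset_lt_trans.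

Definition ltranslate (k : K) (A : set K) : set K := [set (k * a)%g | a in A].

Lemma ltranslate_lcoset k g q : ltranslate k (lcoset g q) = lcoset (k * g)%g q.
Proof.
apply/seteqP; split=> [_ [_ [h hq <-] <-]|_ [h hq <-]].
  by exists h => //; rewrite mulgA.
by exists (g * h)%g; [exists h|rewrite mulgA].
Qed.

Lemma ltranslate_cosets k q (A : cosets q) : ltranslate k (\val A) \in cosets q.
Proof.
have [g _ <-] := set_mem (valP A); rewrite ltranslate_lcoset.
exact: lcoset_mem.
Qed.

Definition coset_act (k : K) (x : coset_poset) : coset_poset :=
  existT _ (tag x) (exist (fun A => A \in cosets (tag x)) _
    (ltranslate_cosets k (tagged x))).

Lemma coset_actE k g q : coset_act k (coset_elt g q) = coset_elt (k * g)%g q.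
Proof.
by congr (existT _ q _); apply/val_inj; exact: ltranslate_lcoset.
Qed.

Fact coset_act_le k : {homo coset_act k : x y / (x <= y)%O}.
Proof.
move=> x y; rewrite !le_eqVlt => /predU1P[->|]; first by rewrite eqxx.
move=> /asboolP[g [q [g' [r [-> -> qr gg']]]]]; apply/orP; right.
apply/asboolP; exists (k * g)%g, q, (k * g')%g, r.
by split; rewrite ?coset_actE // invgM -mulgA mulKg.
Qed.

HB.instance Definition _ k :=
  Order.isOrderMorphism.Build d coset_poset d coset_poset (coset_act k)
    (@coset_act_le k).

Definition coset_Kcat : Kcat K.
Proof.
refine (@KCat K (poset_cat coset_poset) (fun k => poset_functor (coset_act k)) _ _).
- apply: poset_functor_eq => x; have [g ->] := coset_elt_ex x.
  by rewrite [LHS]coset_actE mul1g.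
- move=> a b; apply: poset_functor_eq => x; have [g ->] := coset_elt_ex x.
  by rewrite [LHS]coset_actE /= !coset_actE mulgA.
Defined.
End CosetPoset.

(* Main.v *)
From HB Require Import structures.
From Stdlib Require Import Relation_Operators.
From mathcomp Require Import all_boot all_order all_algebra generic_quotient.
From mathcomp Require Import all_classical all_reals all_analysis.
From mathcomp Require Import lra ring.
Require Import Defs.
Import Order.TTheory GRing.Theory Num.Theory.
Import numFieldNormedType.Exports.

(** The functor is the tautological one: [F q] is the discrete category on the
    cosets [K / G(q)], with [K] acting by translation and [F p -> F q] sending
    [k G(p)] to [k G(q)].  Its realization is discrete, and the coset poset is its
    Grothendieck construction: a chain of cosets is a chain of [Q] together with
    one coset over the least vertex.  Hence [|P|] and [hocolim |F|] have the same
    cells glued in the same way, and they are homeomorphic ([to_hocolimK],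
    [of_hocolimK]).

    The same bijection of cells gives a continuous bijection from
    [hocolim (EK *_K |F|)] to [EK *_K |P|] ([collect]).  Its inverse need not be
    continuous, because [EK * |P|] carries the product topology and a product of
    CW complexes is not a CW complex in general.  The remedy is Milnor's: a
    homotopy shrinks every point of [|P|] towards its vertices of large weight,
    inside each simplex.  At the end of the homotopy all points near a given one
    lie on one fixed simplex and have continuous coordinates there
    ([shrink_carried_near], [carried_by_chain]), so the inverse of [collect]
    becomes continuous after shrinking ([shrunk_slice_continuous]).  Since the
    homotopy depends only on the chain of [Q] below a simplex, it acts on both
    sides, and [borel_hocolim] follows.

    For the fibration, a point of [EK] is a step function on the unit interval with
    values in [K]: the vertices of a simplex are its values and the barycentric
    coordinates are the lengths of its steps.  The step functions that take the
    value [k] on more than half of a given window form an open set which is disjoint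
    from its other translates.
    So [K] acts properly discontinuously ([EG_properly_discontinuous]), and
    [EK -> BK] is a covering.  Homotopies lift locally to a covering, uniquely up
    to [K]; transporting the fibre coordinate along these lifts gives the homotopy
    lifting property of [EK *_K X -> BK] for every [K]-space [X]
    ([associated_bundle_fibration]).

    Last, [EK *_K K/G(q)] is [EK / G(q)].  A [G(q)]-equivariant map from [K] to
    [G(q)] exists because [G(q)] acts freely on [K], and any two maps of vertices
    between indiscrete categories have homotopic realizations, naturally in both
    maps ([join_homotopy_natural]); so [EK / G(q)] is homotopy equivalent to
    [BG(q)] ([borel_coset_BG]). *)

Set Implicit Arguments.
Unset Strict Implicit.
Unset Printing Implicit Defensive.

Local Open Scope classical_set_scope.
Local Open Scope ring_scope.

(** * Quotients, products and the unit interval *)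

Lemma ipi_openP (T : topologicalType) (r : T -> T -> Prop)
    (A : set (identify r)) : open A <-> open (ipi r @^-1` A).
Proof. by []. Qed.

Lemma ipi_eqP (T : topologicalType) (r : T -> T -> Prop) x y :
  ipi r x = ipi r y <-> clos_refl_sym_trans T r x y.
Proof.
split; first by move/eqmodP/asboolP.
by move=> xy; apply/eqmodP/asboolP.
Qed.

Lemma identify_continuous (T Z : topologicalType) (r : T -> T -> Prop)
    (f : identify r -> Z) : continuous (f \o ipi r) -> continuous f.
Proof. by move=> cf; apply/quotient_continuous. Qed.

(** The product of a quotient map with a locally compact space is a quotient map.
    It lets homotopies be defined before gluing. *)
Lemma identify_prod_continuous (T V Z : topologicalType) (r : T -> T -> Prop)
    (g : identify r * V -> Z) :
  locally_compact [set: V] -> hausdorff_space V ->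
  continuous (fun z : T * V => g (ipi r z.1, z.2)) -> continuous g.
Proof.
move=> lV hV cg.
have [cc cc2] := continuous_curry cg.
have -> : g = uncurry (curry g) by apply/funext => -[].
apply: continuous_uncurry => //.
  apply: (@identify_continuous T {compact-open, V -> Z} r); exact: cc.
move=> q; have [x <-] := ipi_surj q; exact: cc2.
Qed.

Lemma sigT_dep_continuous (I : choiceType) (X : I -> topologicalType)
    (Z : topologicalType) (f : {i & X i} -> Z) :
  (forall i, continuous (fun x => f (existT X i x))) -> continuous f.
Proof. by move=> cf [i x] O fO; exact: (cf i x O fO). Qed.

Lemma sigT_prod_continuous (I : choiceType) (X : I -> topologicalType)
    (V Z : topologicalType) (f : {i & X i} * V -> Z) :
  (forall i, continuous (fun z : X i * V => f (existT X i z.1, z.2))) ->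
  continuous f.
Proof.
move=> cf [[i x] v] O /= fO.
have /= [[A B]/= [xA vB] AB] := cf i (x, v) O fO.
exists (existT X i @` A, B); first by split => //=; exact: existT_nbhs.
by move=> [_ w] /= [[y Ay <-] Bw]; exact: (AB (y, w)).
Qed.

Lemma continuous_open_nbhsP (T Z : topologicalType) (f : T -> Z) x :
  {for x, continuous f} <->
  forall O : set Z, open O -> O (f x) -> exists U : set T,
    [/\ open U, U x & forall y, U y -> O (f y)].
Proof.
split=> [cf O oO Ofx|H O].
  have : nbhs x (f @^-1` O) by apply: cf; exact: open_nbhs_nbhs.
  by rewrite nbhsE => -[U [oU Ux] UO]; exists U.
rewrite nbhsE => -[U [oU Ux] UO].
have [W [oW Wx WU]] := H U oU Ux.
rewrite nbhsE /=; exists W => // y Wy; exact/UO/WU.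
Qed.

Lemma continuousT_comp (T U V : topologicalType) (g : U -> V) (f : T -> U) :
  continuous g -> continuous f -> continuous (fun x => g (f x)).
Proof. by move=> cg cf x; apply: continuous_comp; [exact: cf|exact: cg]. Qed.

Lemma continuousT_pair (T U V : topologicalType) (f : T -> U) (g : T -> V) :
  continuous f -> continuous g -> continuous (fun x => (f x, g x)).
Proof. by move=> cf cg x; apply: cvg_pair; [exact: cf|exact: cg]. Qed.

Lemma continuous_at_pair (T U V : topologicalType) (f : T -> U) (g : T -> V) x :
  {for x, continuous f} -> {for x, continuous g} ->
  {for x, continuous (fun y => (f y, g y))}.
Proof. by move=> cf cg; apply: cvg_pair. Qed.

Lemma near_eq_continuous (T U : topologicalType) (f g : T -> U) x :
  (\forall y \near x, f y = g y) -> {for x, continuous f} ->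
  {for x, continuous g}.
Proof.
move=> fg cf; rewrite /prop_for /continuous_at -(nbhs_singleton fg).
apply: cvg_trans; last exact: cf.
exact: near_eq_cvg.
Qed.

Lemma fst_continuous (T U : topologicalType) : continuous (@fst T U).
Proof. by move=> x; exact: cvg_fst. Qed.

Lemma snd_continuous (T U : topologicalType) : continuous (@snd T U).
Proof. by move=> x; exact: cvg_snd. Qed.

Lemma id_continuous (T : topologicalType) : continuous (@id T).
Proof. by move=> x; exact: cvg_id. Qed.

Section RealFunctions.
Variables (R : realType) (T : topologicalType).
Implicit Types f g : T -> R.

Lemma continuousT_max f g : continuous f -> continuous g ->
  continuous (fun x => Num.max (f x) (g x)).
Proof.
move=> cf cg; exact: (continuousT_comp (@max_continuous _ R) (continuousT_pair cf cg)).
Qed.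

Lemma continuousT_min f g : continuous f -> continuous g ->
  continuous (fun x => Num.min (f x) (g x)).
Proof.
move=> cf cg; exact: (continuousT_comp (@min_continuous _ R) (continuousT_pair cf cg)).
Qed.

Lemma continuousT_add f g : continuous f -> continuous g ->
  continuous (fun x => f x + g x).
Proof. by move=> cf cg x; apply: cvgD; [exact: cf|exact: cg]. Qed.

Lemma continuousT_sub f g : continuous f -> continuous g ->
  continuous (fun x => f x - g x).
Proof. by move=> cf cg x; apply: cvgB; [exact: cf|exact: cg]. Qed.

Lemma continuousT_mul f g : continuous f -> continuous g ->
  continuous (fun x => f x * g x).
Proof. by move=> cf cg x; apply: cvgM; [exact: cf|exact: cg]. Qed.

Lemma continuousT_inv f : continuous f -> (forall x, f x != 0) ->
  continuous (fun x => (f x)^-1).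
Proof. by move=> cf f0 x; apply: cvgV; [exact: f0|exact: cf]. Qed.

Lemma continuousT_sum (I : Type) (r : seq I) (P : pred I) (F : I -> T -> R) :
  (forall i, P i -> continuous (F i)) ->
  continuous (fun x => \sum_(i <- r | P i) F i x).
Proof.
move=> cF; elim: r => [|i r IH].
  by under eq_fun do rewrite big_nil; exact: cst_continuous.
under eq_fun do rewrite big_cons.
by case: (boolP (P i)) => // Pi; apply: continuousT_add => //; exact: cF.
Qed.

End RealFunctions.

Section UnitInterval.
Variable R : realType.
Local Notation I := (@unit_interval R).

Lemma unit_interval_val_continuous : continuous (val : I -> R).
Proof. exact: initial_continuous. Qed.

Lemma unit_interval_hausdorff : hausdorff_space I.
Proof.
move=> x y xy; apply: val_inj; apply: Rhausdorff => A B xA yB.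
have [||z [Az Bz]] := xy (val @^-1` A) (val @^-1` B).
- exact: (@unit_interval_val_continuous x _ xA).
- exact: (@unit_interval_val_continuous y _ yB).
by exists (val z).
Qed.

(** The retraction of the line onto the interval extends homotopies to real time. *)
Definition clamp_fun (t : R) : R := Num.max 0 (Num.min t 1).

Lemma clamp_in t : clamp_fun t \in I.
Proof.
rewrite inE /unit_interval /= in_itv /=  /clamp_fun le_max lexx /=.
by rewrite ge_max ler01 ge_min lexx orbT.
Qed.

Definition clamp (t : R) : I := exist _ (clamp_fun t) (clamp_in t).

Lemma unit_interval_ge0 (t : I) : 0 <= val t.
Proof.
by have := set_mem (valP t); rewrite /unit_interval /= in_itv /= => /andP[].
Qed.

Lemma unit_interval_le1 (t : I) : val t <= 1.
Proof.
by have := set_mem (valP t); rewrite /unit_interval /= in_itv /= => /andP[].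
Qed.

Lemma clampK (t : I) : clamp (val t) = t.
Proof.
apply: val_inj => /=; rewrite /clamp_fun (min_idPl (unit_interval_le1 t)).
exact/max_idPr/unit_interval_ge0.
Qed.

Lemma clamp_continuous : continuous clamp.
Proof.
apply: (@continuous_comp_initial I R R val clamp).
apply: continuousT_max; first exact: cst_continuous.
by apply: continuousT_min; [exact: id_continuous|exact: cst_continuous].
Qed.

Lemma unit_interval_compact : compact [set: I].
Proof.
have -> : [set: I] = clamp @` `[0, 1]%classic.
  apply/esym/seteqP; split=> // t _; exists (val t); last exact: clampK.
  exact: (set_mem (valP t)).
apply: continuous_compact; last exact: segment_compact.
by apply: continuous_subspaceT; exact: clamp_continuous.
Qed.

Lemma unit_interval_locally_compact : locally_compact [set: I].
Proof.
move=> t _; exists setT; first by rewrite withinET; exact: filterT.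
by split; [exact: unit_interval_compact|exact: closedT].
Qed.

End UnitInterval.

(** * Orbit spaces and local lifts of homotopies *)

Section OrbitSpaces.
Variable K : groupType.
Implicit Types X : Kspace K.

Lemma kactK X (k : K) : cancel (@kact K X k) (kact k^-1%g).
Proof. by move=> x; rewrite -kactM mulVg kact1. Qed.

Lemma kactKV X (k : K) : cancel (@kact K X k^-1%g) (kact k).
Proof. by move=> x; rewrite -kactM mulgV kact1. Qed.

Lemma orbit_pi_eqP X (x y : X) : orbit_pi x = orbit_pi y <-> orbit_rel x y.
Proof.
split=> [/ipi_eqP|xy]; last exact: ipi_eq.
elim=> {x y} [//|x|x y _ [k ->]|x y z _ [k ->] _ [l ->]].
- by exists 1%g; rewrite kact1.
- by exists k^-1%g; rewrite kactK.
- by exists (l * k)%g; rewrite kactM.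
Qed.

Lemma orbit_pi_act X (k : K) (x : X) : orbit_pi (kact k x) = orbit_pi x.
Proof. by apply/esym/orbit_pi_eqP; exists k. Qed.

Lemma orbit_pi_continuous X : continuous (@orbit_pi K X).
Proof. exact: ipi_continuous. Qed.

Lemma orbit_pi_open X (U : set X) : open U -> open (@orbit_pi K X @` U).
Proof.
move=> oU; apply/ipi_openP.
have -> : ipi (@orbit_rel K X) @^-1` (@orbit_pi K X @` U) =
    \bigcup_k (kact k @^-1` U).
  apply/seteqP; split=> x.
    by move=> [y Uy /esym /orbit_pi_eqP[k kE]]; exists k; rewrite //= -kE.
  by move=> [k _ Ukx]; exists (kact k x) => //; exact: orbit_pi_act.
apply: bigcup_open => k _.
by apply: open_comp => // x _; exact: kact_continuous.
Qed.

Lemma orbit_pi_nbhs X (x : X) (U : set X) :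
  nbhs x U -> nbhs (orbit_pi x) (@orbit_pi K X @` U).
Proof.
rewrite nbhsE => -[V [oV Vx] VU]; rewrite nbhsE.
exists (@orbit_pi K X @` V); last exact: image_subset.
by split; [exact: orbit_pi_open|exists x].
Qed.

(** Orbit maps are open, so their product with any space is still a quotient map,
    without local compactness. *)
Lemma orbit_prod_continuous X (S Z : topologicalType)
    (g : orbit_space X * S -> Z) :
  continuous (fun z : X * S => g (orbit_pi z.1, z.2)) -> continuous g.
Proof.
move=> cg [q s] O gO; have [x xq] := ipi_surj q; rewrite -/(orbit_pi x) in xq.
case: _ / xq gO => gO.
have /= [[A B] /= [xA sB] AB] := cg (x, s) O gO.
exists (@orbit_pi K X @` A, B); first by split => //=; exact: orbit_pi_nbhs.
by move=> [_ w] /= [[y Ay <-] Bw]; exact: (AB (y, w)).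
Qed.

End OrbitSpaces.

Definition properly_discontinuous (K : groupType) (E : Kspace K) :=
  forall e : E, exists W : set E, [/\ open W, W e &
    forall k w, W w -> W (kact k w) -> k = 1%g].

Section LocalLifts.
Variables (R : realType) (K : groupType) (E : Kspace K).
Hypothesis pdE : properly_discontinuous E.

Lemma properly_discontinuous_free (k : K) (e : E) : kact k e = e -> k = 1%g.
Proof. by have [W [_ We Wf]] := pdE e => ke; apply: (Wf k e); rewrite ?ke. Qed.

(** The continuous form of uniqueness of lifts: both maps stay in a set that meets
    each orbit once. *)
Lemma lifts_agree_near (T : topologicalType) (u v : T -> E) x :
  {for x, continuous u} -> {for x, continuous v} ->
  (\forall y \near x, orbit_pi (u y) = orbit_pi (v y)) -> u x = v x ->
  \forall y \near x, u y = v y.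
Proof.
move=> cu cv uv xuv; have [W [oW Wu Wf]] := pdE (u x).
have Wx : \forall y \near x, W (u y) by apply: cu; exact: open_nbhs_nbhs.
have Wx' : \forall y \near x, W (v y).
  by apply: cv; apply: open_nbhs_nbhs; rewrite -xuv.
near=> y; have /orbit_pi_eqP[k vk] : orbit_pi (u y) = orbit_pi (v y) by near: y.
have : k = 1%g by apply: (Wf k (u y)); [near: y|rewrite -vk; near: y].
by move=> k1; rewrite vk k1 kact1.
Unshelve. all: by end_near. Qed.

Lemma local_section (e : E) : exists (V : set (orbit_space E))
    (sigma : orbit_space E -> E),
  [/\ open V, V (orbit_pi e) & forall b, V b ->
    orbit_pi (sigma b) = b /\ {for b, continuous sigma}].
Proof.
have [W [oW We Wf]] := pdE e.
have H b : exists w, (@orbit_pi K E @` W) b -> W w /\ orbit_pi w = b.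
  have [[w Ww wb]|nb] := pselect ((@orbit_pi K E @` W) b); first by exists w.
  by exists e.
have [sigma sE] := choice H.
exists (@orbit_pi K E @` W), sigma; split; [exact: orbit_pi_open|by exists e|].
move=> b Wb; have [Ws sb] := sE b Wb; split => //.
apply/continuous_open_nbhsP => O oO Os.
exists (@orbit_pi K E @` (O `&` W)); split.
- by apply: orbit_pi_open; exact: openI.
- by exists (sigma b).
move=> _ [w [Ow Ww] <-].
have [] := sE (orbit_pi w); first by exists w.
move=> Wsw /esym /orbit_pi_eqP [k swk].
by move: Wsw; rewrite swk => /(Wf _ _ Ww) k1; rewrite k1 kact1.
Qed.

(** For each [k] the times at which [c1] is the [k]-translate of [c2] form an open
    set, and these sets partition the line, which is connected. *)
Lemma paths_lift_unique (c1 c2 : R -> E) : continuous c1 -> continuous c2 ->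
  (forall t, orbit_pi (c1 t) = orbit_pi (c2 t)) ->
  exists k, forall t, c1 t = kact k (c2 t).
Proof.
move=> cc1 cc2 c12.
have ex t : exists k, c1 t = kact k (c2 t).
  by have /esym /orbit_pi_eqP[k ->] := c12 t; exists k.
have oS k : open [set t | c1 t = kact k (c2 t)].
  rewrite openE => t /= tk.
  apply: (@lifts_agree_near _ c1 (fun s => kact k (c2 s))) => //.
  - exact: cc1.
  - by apply: continuous_comp; [exact: cc2|exact: kact_continuous].
  - by near=> s; rewrite orbit_pi_act.
have [k k0] := ex 0; exists k => t.
have cR : connected [set: R] by apply/connected_intervalP => ? ? ? ? ?.
suff : [set t | c1 t = kact k (c2 t)] = setT by move/seteqP => [_ ]; apply.
apply: cR; first by exists 0.
- by exists [set t | c1 t = kact k (c2 t)] => //; rewrite setTI.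
exists [set t | c1 t = kact k (c2 t)]; last by rewrite setTI.
rewrite -openC.
have -> : ~` [set t | c1 t = kact k (c2 t)] =
    \bigcup_(l in [set l | l <> k]) [set t | c1 t = kact l (c2 t)].
  apply/seteqP; split=> s /=.
    by have [l sl] := ex s => sk; exists l => //= lk; rewrite -lk in sk.
  move=> [l /= lk sl] sk; apply: lk; apply: (mulIg k^-1%g); rewrite mulgV.
  apply: (@properly_discontinuous_free _ (c1 s)).
  by rewrite {1}sk kactM kactK -sl.
by apply: bigcup_open => l _.
Unshelve. all: by end_near. Qed.

Section Lifting.
Variables (Y : topologicalType) (H : Y * R -> orbit_space E).
Hypothesis cH : continuous H.

(** The time is clamped to the interval from [a] to [b], so that a lift over that
    interval is a function of all real times and needs no subspace topology. *)
Definition has_lift (y0 : Y) (a b : R) := exists l : Y * R -> E,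
  \forall y \near y0, forall s, {for (y, s), continuous l} /\
    orbit_pi (l (y, s)) = H (y, Num.max a (Num.min s b)).

Lemma has_lift_near y0 t0 : exists2 d, 0 < d & forall a b,
  t0 - d < a -> a <= b -> b < t0 + d -> has_lift y0 a b.
Proof.
have [e eE] := ipi_surj (H (y0, t0)); rewrite -/(orbit_pi e) in eE.
have [V [sigma [oV Ve sV]]] := local_section e; rewrite eE in Ve.
have /= [[A B] /= [yA tB] AB] : nbhs (y0, t0) (H @^-1` V).
  by apply: cH; exact: open_nbhs_nbhs.
have /nbhs_ballP [d /= d0 dB] := tB.
exists d => // a b ta ab bt.
exists (fun z => sigma (H (z.1, Num.max a (Num.min z.2 b)))).
near=> y => s /=.
have Vys : V (H (y, Num.max a (Num.min s b))).
  apply: (AB (y, _)); split => /=; first by near: y.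
  apply: dB; rewrite /ball /= ltr_distlC.
  rewrite lt_max ta /= gt_max gt_min bt orbT andbT; lra.
have [-> cs] := sV _ Vys; split => //.
apply: (@continuous_comp _ _ _ (fun z => H (z.1, Num.max a (Num.min z.2 b))) sigma) => //.
apply: continuousT_comp => //; apply: continuousT_pair; first exact: fst_continuous.
apply: continuousT_max; first exact: cst_continuous.
by apply: continuousT_min; [exact: snd_continuous|exact: cst_continuous].
Unshelve. all: by end_near. Qed.

(** A translation makes the two lifts agree at [(y0, m)], hence at [(y, m)] for [y]
    near [y0]. *)
Lemma has_lift_glue y0 a m b : a <= m -> m <= b ->
  has_lift y0 a m -> has_lift y0 m b -> has_lift y0 a b.
Proof.
move=> am mb [l1 L1] [l2 L2].
have mE1 : Num.max a (Num.min m m) = m by rewrite minxx; exact/max_idPr.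
have mE2 : Num.max m (Num.min m b) = m by rewrite (min_idPl mb) maxxx.
have [_ e1] := nbhs_singleton L1 m; have [_ e2] := nbhs_singleton L2 m.
have /orbit_pi_eqP [k kE] : orbit_pi (l2 (y0, m)) = orbit_pi (l1 (y0, m)).
  by rewrite e1 e2 mE1 mE2.
have pair_m : continuous (fun y : Y => (y, m)).
  by apply: continuousT_pair; [exact: id_continuous|exact: cst_continuous].
have agree : \forall y \near y0, l1 (y, m) = kact k (l2 (y, m)).
  apply: lifts_agree_near => //.
  - apply: (@continuous_comp _ _ _ (fun y => (y, m)) l1); first exact: pair_m.
    by have [] := nbhs_singleton L1 m.
  - apply: (@continuous_comp _ _ _ (fun y => l2 (y, m)) (kact k)); last exact: kact_continuous.
    apply: (@continuous_comp _ _ _ (fun y => (y, m)) l2); first exact: pair_m.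
    by have [] := nbhs_singleton L2 m.
  - apply: filterS2 L1 L2 => y /(_ m)[_ p1] /(_ m)[_ p2].
    by rewrite orbit_pi_act p1 p2 mE1 mE2.
exists (fun z => if z.2 <= m then l1 z else kact k (l2 z)).
near=> y.
have L1y : forall s, {for (y, s), continuous l1} /\
  orbit_pi (l1 (y, s)) = H (y, Num.max a (Num.min s m)) by near: y.
have L2y : forall s, {for (y, s), continuous l2} /\
  orbit_pi (l2 (y, s)) = H (y, Num.max m (Num.min s b)) by near: y.
have ym : l1 (y, m) = kact k (l2 (y, m)) by near: y.
move=> s; have [c1 p1] := L1y s; have [c2 p2] := L2y s.
have c2k : {for (y, s), continuous (fun z => kact k (l2 z))}.
  by apply: continuous_comp => //; exact: kact_continuous.
split; last first.
  rewrite /=; case: ifPn => [sm|]; last rewrite -ltNge => ms.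
    by rewrite p1 (min_idPl sm) (min_idPl (le_trans sm mb)).
  rewrite orbit_pi_act p2; congr (H (_, _)).
  have mm : m <= Num.min s b by rewrite le_min mb ltW.
  by rewrite (max_idPr mm) (max_idPr (le_trans am mm)).
move=> O /= lO.
have lim1 : s <= m -> nbhs (l1 (y, s)) O by move=> sm; rewrite sm in lO.
have lim2 : m <= s -> nbhs (kact k (l2 (y, s))) O.
  rewrite le_eqVlt => /predU1P[ms|ms]; last by rewrite leNgt ms in lO.
  by move: lO; rewrite -ms lexx ym.
have near_snd (P : set R) : nbhs s P -> \forall z \near (y, s), P z.2.
  exact: (@snd_continuous Y R (y, s) P).
have N1 : \forall z \near (y, s), z.2 <= m -> O (l1 z).
  have [sm|ms] := leP s m.
    have lO1 : \forall z \near (y, s), O (l1 z) := c1 O (lim1 sm).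
    by apply: filterS lO1.
  have /near_snd : \forall x \near s, m < x by exact: lt_nbhsr.
  by apply: filterS => z mz /(lt_le_trans mz); rewrite ltxx.
have N2 : \forall z \near (y, s), m < z.2 -> O (kact k (l2 z)).
  have [ms|sm] := leP m s.
    have lO2 : \forall z \near (y, s), O (kact k (l2 z)) := c2k O (lim2 ms).
    by apply: filterS lO2.
  have /near_snd : \forall x \near s, x < m by exact: lt_nbhsl.
  by apply: filterS => z zm /(lt_trans zm); rewrite ltxx.
apply: filterS2 N1 N2 => z /= N1z N2z.
by case: ifPn => // zm; apply: N2z; rewrite ltNge.
Unshelve. all: by end_near. Qed.

(** Compactness of the interval, in the form of a supremum of the times up to which
    a lift exists on a common neighbourhood of [y0]. *)
Lemma has_lift01 y0 : has_lift y0 0 1.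
Proof.
pose A := [set t | 0 <= t <= 1 /\ has_lift y0 0 t].
have A0 : A 0.
  split; first by rewrite lexx ler01.
  by have [d d0] := has_lift_near y0 0; apply; lra.
have supA : has_sup A by split; [exists 0|exists 1 => t [/andP[]]].
have s0 : 0 <= sup A by apply: sup_upper_bound.
have s1 : sup A <= 1 by apply: ge_sup; [exists 0|move=> t [/andP[]]].
have [d d0 dA] := has_lift_near y0 (sup A).
have [t [/andP[t0 t1] At] st] := sup_adherent d0 supA.
have ts : t <= sup A by apply: sup_upper_bound => //; split=> //; apply/andP.
pose t' := Num.min (sup A + d / 2) 1.
have tt' : t <= t' by rewrite le_min t1 andbT; lra.
have At' : has_lift y0 0 t'.
  apply: (has_lift_glue t0 tt') => //; apply: dA => //.
  by rewrite gt_min; apply/orP; left; lra.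
have : t' <= sup A.
  apply: sup_upper_bound => //; split=> //; rewrite (le_trans t0 tt') /=.
  by rewrite ge_min lexx orbT.
rewrite ge_min => /orP[|s1']; first by lra.
suff <- : t' = 1 by [].
by apply/min_idPr; lra.
Qed.

End Lifting.
End LocalLifts.

(** * Bundles associated with a covering *)

Section AssociatedBundle.
Variables (R : realType) (K : groupType) (E X : Kspace K).
Hypothesis pdE : properly_discontinuous E.
Local Notation I := (@unit_interval R).
Local Notation EX := (prod_Kspace E X).
Local Notation proj := (orbit_map (fst_Kmap E X)).
Local Notation cls e x := (@orbit_pi K EX (e, x)).

Lemma proj_cls e x : proj (cls e x) = orbit_pi e.
Proof. exact: orbit_mapE. Qed.

Lemma cls_ex e z : proj z = orbit_pi e -> exists x, z = cls e x.
Proof.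
have [[e' x] <-] := ipi_surj z; rewrite -/(orbit_pi _) proj_cls.
by move=> /orbit_pi_eqP [k ->]; exists (kact k x); apply/orbit_pi_eqP; exists k.
Qed.

Lemma cls_inj e x y : cls e x = cls e y -> x = y.
Proof.
move=> /orbit_pi_eqP[k /= [ke ->]].
by rewrite (properly_discontinuous_free pdE (esym ke)) kact1.
Qed.

(** Once a lift to [E] is chosen, a point of the bundle has a well-defined
    coordinate in [X]; this is the local triviality of the bundle. *)
Lemma fibre_coordinate_continuous (Y : topologicalType)
    (f : Y -> orbit_space EX) (l : Y -> E) (xi : Y -> X) y0 :
  {for y0, continuous f} -> {for y0, continuous l} ->
  (\forall y \near y0, f y = cls (l y) (xi y)) -> {for y0, continuous xi}.
Proof.
move=> cf cl fE O xO.
have [W [oW Wl Wf]] := pdE (l y0).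
have fy0 := nbhs_singleton fE.
have WO : \forall y \near y0, (@orbit_pi K EX @` (W `*` O)) (f y).
  apply: cf; rewrite fy0; apply: orbit_pi_nbhs.
  by exists (W, O) => //; split => //; exact: open_nbhs_nbhs.
have Wy : \forall y \near y0, W (l y) by apply: cl; exact: open_nbhs_nbhs.
apply: filterS3 fE Wy WO => y /= -> Wly [[w x] /= [Ww Ox] /(@orbit_pi_eqP K EX)[k /= [lk xk]]].
by move: Wly; rewrite lk => /(Wf _ _ Ww) k1; rewrite xk k1 kact1.
Qed.

(** Parallel transport: the lifted homotopy follows a lift [l] of [H] to [E] and
    keeps the fibre coordinate [xi] of its starting point.  Another lift differs
    from [l] by a constant [k], which changes [xi] by [k] and not the class. *)
Lemma associated_bundle_fibration :
  fibration R (proj : orbit_space EX -> orbit_space E).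
Proof.
split=> [|Y f H cf cH Hf]; first exact: orbit_map_continuous.
pose H' (z : Y * R) := H (z.1, clamp z.2).
have cH' : continuous H'.
  apply: continuousT_comp => //; apply: continuousT_pair; first exact: fst_continuous.
  by apply: continuousT_comp; [exact: clamp_continuous|exact: snd_continuous].
have lifts (y0 : Y) : exists l : Y * R -> E, \forall y \near y0, forall s,
    {for (y, s), continuous l} /\ orbit_pi (l (y, s)) = H (y, clamp s).
  have [l L] := has_lift01 pdE cH' y0; exists l; apply: filterS L => y L s.
  by have [? ->] := L s; split=> //; congr (H (_, _)); rewrite -[RHS]clampK.
have {lifts} [l lL] := choice lifts.
have coord (p : E * orbit_space EX) : exists x,
    proj p.2 = orbit_pi p.1 -> p.2 = cls p.1 x.
  have [/cls_ex[x ->]|] := pselect (proj p.2 = orbit_pi p.1); first by exists x.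
  by have [[e' x] _] := ipi_surj p.2; exists x.
have [xi0 xi0E] := choice coord.
(* [l y0] and [xi y0] are meaningful near [y0]; [L] uses each at its own centre *)
pose xi y0 y := xi0 (l y0 (y, 0), f y).
have xiE (y0 : Y) : \forall y \near y0, f y = cls (l y0 (y, 0)) (xi y0 y).
  apply: filterS (lL y0) => y /(_ 0)[_ p0]; rewrite /xi.
  by apply: (xi0E (_, _)) => /=; rewrite p0 (Hf y (clamp 0)) //= /clamp_fun
    (min_idPl ler01) maxxx.
pose L (z : Y * I) := cls (l z.1 (z.1, val z.2)) (xi z.1 z.1).
have LE (y0 : Y) : \forall y \near y0, forall t : I,
    L (y, t) = cls (l y0 (y, val t)) (xi y0 y).
  apply: filterS2 (lL y0) (xiE y0) => y l0 xi0y t.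
  have l1 := nbhs_singleton (lL y); have xi1y := nbhs_singleton (xiE y).
  have cl y1 : (forall s, {for (y, s), continuous (l y1)} /\
      orbit_pi (l y1 (y, s)) = H (y, clamp s)) ->
      continuous (fun s => l y1 (y, s)).
    move=> cy1 s; apply: (@continuous_comp _ _ _ (fun s => (y, s)) (l y1)).
      by apply: continuousT_pair; [exact: cst_continuous|exact: id_continuous].
    by have [] := cy1 s.
  have [|k kE] := @paths_lift_unique R K E pdE _ _ (cl _ l1) (cl _ l0).
    by move=> s; have [_ ->] := l1 s; have [_ ->] := l0 s.
  rewrite /L /=; apply/esym/(@orbit_pi_eqP K EX); exists k; rewrite /= -kE.
  congr (_, _); apply: (@cls_inj (l y (y, 0))); rewrite -xi1y xi0y.
  by apply/(@orbit_pi_eqP K EX); exists k; rewrite /= -kE.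
exists L; split.
- move=> [y0 t0].
  have near_fst (P : set Y) : nbhs y0 P -> \forall z \near (y0, t0), P z.1.
    exact: (@fst_continuous Y I (y0, t0) P).
  have Lc : \forall z \near (y0, t0),
      cls (l y0 (z.1, val z.2)) (xi y0 z.1) = L z.
    by apply: filterS (near_fst _ (LE y0)) => -[y t] /= ->.
  apply: near_eq_continuous Lc _.
  have l0 := nbhs_singleton (lL y0).
  have cxi : {for y0, continuous (xi y0)}.
    apply: (fibre_coordinate_continuous (f := f) (l := fun y => l y0 (y, 0))) => //.
      exact: cf.
    apply: (@continuous_comp _ _ _ (fun y => (y, 0)) (l y0)).
      by apply: continuousT_pair; [exact: id_continuous|exact: cst_continuous].
    by have [] := l0 0.
  apply: (@continuous_comp _ _ _
    (fun z : Y * I => (l y0 (z.1, val z.2), xi y0 z.1)) (@orbit_pi K EX)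
    (y0, t0)); last exact: orbit_pi_continuous.
  apply: continuous_at_pair.
    apply: (@continuous_comp _ _ _ (fun z : Y * I => (z.1, val z.2)) (l y0)).
      apply: continuousT_pair; first exact: fst_continuous.
      by apply: continuousT_comp; [exact: unit_interval_val_continuous|exact: snd_continuous].
    by have [] := l0 (val t0).
  apply: (@continuous_comp _ _ _ (@fst Y I) (xi y0)).
    exact: fst_continuous.
  exact: cxi.
- move=> y t t0; rewrite /L /= t0.
  exact/esym/(nbhs_singleton (xiE y)).
- move=> [y t]; rewrite proj_cls /=.
  by have [_ ->] := nbhs_singleton (lL y) (val t); rewrite clampK.
Qed.

(** The fibre has the topology of [X], because an open set [U] of [X] is cut out by
    the image of [W * U], where [W] meets each orbit once. *)
Lemma associated_bundle_fibration_sequence (e : E) :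
  fibration_sequence R (fun x : X => cls e x) proj (orbit_pi e).
Proof.
split.
- exact: associated_bundle_fibration.
- exact: (continuousT_comp (@orbit_pi_continuous K EX)
    (continuousT_pair (@cst_continuous X E e) (@id_continuous X))).
- by move=> x y; exact: cls_inj.
- apply/seteqP; split=> [_ [x _ <-]|z /= /cls_ex[x ->]]; first exact: proj_cls.
  by exists x.
move=> U oU; have [W [oW We Wf]] := pdE e.
exists (@orbit_pi K EX @` (W `*` U)).
  apply: orbit_pi_open; rewrite openE => -[w u] [/= Ww Uu].
  by exists (W, U) => //; split; exact: open_nbhs_nbhs.
apply/seteqP; split=> x /=; first by move=> Ux; exists (e, x).
move=> [[w u] /= [Ww Uu] /esym /(@orbit_pi_eqP K EX)[k /= [wk uk]]].
by move: Ww Uu; rewrite wk uk => /(Wf _ _ We) ->; rewrite kact1.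
Qed.

End AssociatedBundle.

(** * Realizations, cell by cell *)

Section Simplex.
Variable R : realType.

Definition scoord n (s : simplex R n) (i : 'I_n.+1) : R := (val s) ord0 i.

Lemma scoord_ge0 n (s : simplex R n) i : 0 <= scoord s i.
Proof. have [s0 _] := set_mem (valP s); exact: s0. Qed.

Lemma scoord_sum n (s : simplex R n) : \sum_i scoord s i = 1.
Proof. have [_ s1] := set_mem (valP s); exact: s1. Qed.

Lemma simplex_eq n (s s' : simplex R n) : scoord s =1 scoord s' -> s = s'.
Proof.
move=> ss'; apply/val_inj/matrixP => i j; rewrite (ord1 i); exact: ss'.
Qed.

Lemma mk_simplex_subproof n (w : 'I_n.+1 -> R) :
  (forall i, 0 <= w i) /\ \sum_i w i = 1 -> \row_i w i \in simplex R n.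
Proof.
move=> [w0 w1]; apply/mem_set; split=> [i|]; first by rewrite mxE.
by rewrite -[RHS]w1; apply: eq_bigr => i _; rewrite mxE.
Qed.

Definition mk_simplex n (w : 'I_n.+1 -> R)
    (w01 : (forall i, 0 <= w i) /\ \sum_i w i = 1) : simplex R n :=
  exist (fun v => v \in simplex R n) _ (mk_simplex_subproof w01).

Lemma mk_simplexE n w w01 i : scoord (@mk_simplex n w w01) i = w i.
Proof. by rewrite /scoord /= mxE. Qed.

Lemma simplex_pushE m n (t : 'I_m.+1 -> 'I_n.+1) (s : simplex R m) j :
  scoord (simplex_push t s) j = \sum_(i | t i == j) scoord s i.
Proof. by rewrite /scoord /= mxE. Qed.

Lemma simplex_push_sum m n (t : 'I_m.+1 -> 'I_n.+1) (s : simplex R m)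
    (w : 'I_n.+1 -> R) (P : pred 'I_n.+1) :
  \sum_(i | P (t i)) scoord s i * w (t i) =
  \sum_(j | P j) scoord (simplex_push t s) j * w j.
Proof.
rewrite (partition_big t P) //=; apply: eq_bigr => j Pj.
rewrite simplex_pushE mulr_suml; apply: eq_big => [i|i /andP[_ /eqP ->]//].
by case: eqP => [->|]; rewrite ?Pj ?andbF.
Qed.

Lemma simplex_push_mass m n (t : 'I_m.+1 -> 'I_n.+1) (s : simplex R m)
    (P : pred 'I_n.+1) :
  \sum_(i | P (t i)) scoord s i = \sum_(j | P j) scoord (simplex_push t s) j.
Proof.
have := simplex_push_sum t s (fun=> 1) P.
by under eq_bigr do rewrite mulr1; under [in RHS]eq_bigr do rewrite mulr1.
Qed.

Lemma scoord_continuous n (i : 'I_n.+1) :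
  continuous (fun s : simplex R n => scoord s i).
Proof.
have cval : continuous (val : simplex R n -> 'rV[R]_n.+1).
  exact: initial_continuous.
exact: (continuousT_comp (@coord_continuous R 1 n.+1 ord0 i) cval).
Qed.

Lemma simplex_continuous_at n (T : topologicalType) (f : T -> simplex R n) x :
  (forall i, {for x, continuous (fun y => scoord (f y) i)}) ->
  {for x, continuous f}.
Proof.
move=> cf U /= [_ [[V oV <-] /= Vfx] VU].
have [P fP PV] : nbhs (val (f x)) V by exact: open_nbhs_nbhs.
have : \forall y \near x, forall i, P ord0 i (scoord (f y) i).
  by apply: filter_forall => i; apply: cf; exact: fP.
apply: filterS => y Py; apply: VU; apply: PV => i j.
by rewrite (ord1 i); exact: Py.
Qed.

Lemma simplex_continuous n (T : topologicalType) (f : T -> simplex R n) :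
  (forall i, continuous (fun y => scoord (f y) i)) -> continuous f.
Proof. by move=> cf x; apply: simplex_continuous_at => i; exact: cf. Qed.

Lemma scoord_pos n (s : simplex R n) : exists i, 0 < scoord s i.
Proof.
apply/not_existsP => s0; suff : \sum_i scoord s i = 0.
  by rewrite scoord_sum => /eqP; rewrite oner_eq0.
apply: big1 => i _; apply/eqP; rewrite eq_le scoord_ge0 andbT leNgt.
exact/negP/s0.
Qed.

End Simplex.

Section RealizationPoints.
Variables (R : realType) (X : sset).

Definition rcell n (x : X n) (s : simplex R n) : realization R X :=
  ipi (@realization_rel R X) (cell x s).

Lemma rcell_op m n (t : {omorphism 'I_m.+1 -> 'I_n.+1}) (x : X n) s :
  rcell (sop t x) s = rcell x (simplex_push t s).
Proof. by apply: ipi_eq; exact: RealizationRel. Qed.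

Lemma rcell_ex (q : realization R X) : exists n (x : X n) s, q = rcell x s.
Proof. by have [[[n x] s] <-] := ipi_surj q; exists n, x, s. Qed.

Lemma rcell_continuous n (x : X n) : continuous (rcell x).
Proof.
apply: (@continuousT_comp _ _ _ (ipi (@realization_rel R X)) (cell x)).
  exact: ipi_continuous.
exact: (@existT_continuous {classic {n & X n}}
  (fun x => simplex R (projT1 x)) (existT _ n x)).
Qed.

Lemma realization_continuous (Z : topologicalType) (f : realization R X -> Z) :
  (forall n (x : X n), continuous (fun s => f (rcell x s))) -> continuous f.
Proof.
move=> cf; apply: identify_continuous.
apply: (@sigT_dep_continuous {classic {n & X n}}
  (fun x => simplex R (projT1 x))) => -[n x].
exact: cf.
Qed.

Lemma realization_prod_continuous (V Z : topologicalType)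
    (f : realization R X * V -> Z) :
  locally_compact [set: V] -> hausdorff_space V ->
  (forall n (x : X n), continuous (fun z => f (rcell x z.1, z.2))) ->
  continuous f.
Proof.
move=> lV hV cf; apply: identify_prod_continuous => //.
apply: (@sigT_prod_continuous {classic {n & X n}}
  (fun x => simplex R (projT1 x))) => -[n x].
exact: cf.
Qed.

Section Lift.
Variables (Z : Type) (g : forall n, X n -> simplex R n -> Z).
Hypothesis gE : forall m n (t : {omorphism 'I_m.+1 -> 'I_n.+1}) (x : X n) s,
  g (sop t x) s = g x (simplex_push t s).

(** The map out of a realization given by compatible maps on its cells. *)
Definition rlift (q : realization R X) : Z :=
  ilift (fun p : prerealization R X => g (projT2 (projT1 p)) (projT2 p)) q.

Lemma rliftE n (x : X n) s : rlift (rcell x s) = g x s.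
Proof. by rewrite /rlift /rcell iliftE // => _ _ [*]; exact: gE. Qed.

End Lift.

Lemma rlift_continuous (Z : topologicalType)
    (g : forall n, X n -> simplex R n -> Z)
    (gE : forall m n (t : {omorphism 'I_m.+1 -> 'I_n.+1}) (x : X n) s,
      g _ (sop t x) s = g _ x (simplex_push t s)) :
  (forall n (x : X n), continuous (g n x)) -> continuous (rlift g).
Proof.
move=> cg; apply: realization_continuous => n x.
by under eq_fun do rewrite rliftE //; exact: cg.
Qed.

End RealizationPoints.

Lemma realization_map_cell (R : realType) (X Y : sset) (f : smap X Y) n (x : X n)
    (s : simplex R n) :
  realization_map f (rcell x s) = rcell (f n x) s.
Proof. exact: realization_mapE. Qed.

(** * The action of the group on its total space is properly discontinuous *)

Section Cumulative.
Variable R : realType.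

Definition cumul n (s : simplex R n) (j : nat) : R :=
  \sum_(i < n.+1 | (i < j)%N) scoord s i.

Lemma cumul0 n (s : simplex R n) : cumul s 0 = 0.
Proof. by apply: big_pred0 => i; rewrite ltn0. Qed.

Lemma cumulS n (s : simplex R n) (i : 'I_n.+1) :
  cumul s i.+1 = cumul s i + scoord s i.
Proof.
rewrite /cumul (bigD1 i) //= addrC; congr (_ + _); apply: eq_bigl => j.
by rewrite ltnS ltn_neqAle andbC.
Qed.

Lemma cumul_ge0 n (s : simplex R n) j : 0 <= cumul s j.
Proof. by apply: sumr_ge0 => i _; exact: scoord_ge0. Qed.

Lemma cumul_le1 n (s : simplex R n) j : cumul s j <= 1.
Proof.
rewrite -(scoord_sum s) /cumul [leRHS](bigID (fun i : 'I_n.+1 => (i < j)%N)) /=.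
by rewrite lerDl; apply: sumr_ge0 => i _; exact: scoord_ge0.
Qed.

Lemma initial_segmentP n (P : pred 'I_n.+1) :
  (forall i j : 'I_n.+1, (i <= j)%N -> P j -> P i) ->
  exists2 a, (a <= n.+1)%N & forall i : 'I_n.+1, P i = (i < a)%N.
Proof.
move=> downP; pose B a := [forall i : 'I_n.+1, P i ==> (i < a)%N].
have Bn : exists a, B a.
  by exists n.+1; apply/forallP => i; rewrite ltn_ord implybT.
case: (ex_minnP Bn) => a Ba amin; exists a.
  by apply: amin; apply/forallP => i; rewrite ltn_ord implybT.
move=> i; apply/idP/idP => [Pi|ia]; first exact: (implyP (forallP Ba i) Pi).
case: (boolP (P i)) => // nPi.
have /amin : B i; last by rewrite leqNgt ia.
apply/forallP => j; apply/implyP => Pj; rewrite ltnNge; apply/negP => ij.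
by move: nPi; rewrite (downP _ _ ij Pj).
Qed.

(** For a monotone map of simplices the indices sent below a given one form an
    initial segment. *)
Lemma telescope_initial n (s : simplex R n) (h : R -> R) (P : pred 'I_n.+1) :
  (forall i j : 'I_n.+1, (i <= j)%N -> P j -> P i) ->
  \sum_(i | P i) (h (cumul s i.+1) - h (cumul s i)) =
  h (\sum_(i | P i) scoord s i) - h 0.
Proof.
move=> /initial_segmentP[a an Pa].
rewrite (eq_bigl _ _ Pa) [in RHS](eq_bigl _ _ Pa) -/(cumul s a).
rewrite -(big_ord_widen n.+1 (fun i => h (cumul s i.+1) - h (cumul s i))) //.
rewrite -(big_mkord xpredT (fun i => h (cumul s i.+1) - h (cumul s i))).
by rewrite telescope_sumr // cumul0.
Qed.

(** The steps of the step function of [s] that [t] merges are consecutive, and their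
    increments add up to the increment of the merged step. *)
Lemma increment_push m n (t : {omorphism 'I_m.+1 -> 'I_n.+1}) (s : simplex R m)
    (h : R -> R) (j : 'I_n.+1) :
  \sum_(i | t i == j) (h (cumul s i.+1) - h (cumul s i)) =
  h (cumul (simplex_push t s) j.+1) - h (cumul (simplex_push t s) j).
Proof.
have cE a : cumul (simplex_push t s) a = \sum_(i | (t i < a)%N) scoord s i.
  exact/esym/(simplex_push_mass t s (fun j => (j < a)%N)).
have dE a : \sum_(i | (t i < a)%N) (h (cumul s i.+1) - h (cumul s i)) =
    h (cumul (simplex_push t s) a) - h 0.
  rewrite cE telescope_initial // => i l il; apply: leq_ltn_trans.
  exact: (omorph_le t il).
have := dE j.+1; rewrite (bigID (fun i => t i == j)) /=.
under eq_bigl => i.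
  rewrite (_ : _ && _ = (t i == j)); last by case: eqP => [->|]; rewrite ?andbF ?ltnSn.
  over.
under [X in _ + X]eq_bigl => i.
  rewrite (_ : _ && _ = (t i < j)%N); last by rewrite andbC ltnS [in RHS]ltn_neqAle.
  over.
by rewrite dE => /(canRL (addrK _)) ->; rewrite opprB addrA subrK.
Qed.

End Cumulative.

Section TotalSpace.
Variables (R : realType) (K : groupType).

(** The length, measured by [h], of the part of the unit interval on which the step function
    of the point takes the value [k]. *)
Definition label_weight_simplex (h : R -> R) (k : K) n
    (x : nerve (indiscrete_cat K) n) (s : simplex R n) : R :=
  \sum_(i | fobj x i == k) (h (cumul s i.+1) - h (cumul s i)).

Lemma label_weight_op (h : R -> R) (k : K) m n
    (t : {omorphism 'I_m.+1 -> 'I_n.+1}) (x : nerve (indiscrete_cat K) n) s :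
  label_weight_simplex h k (sop t x) s =
  label_weight_simplex h k x (simplex_push t s).
Proof.
rewrite /label_weight_simplex /=.
rewrite (partition_big t (fun j => fobj x j == k)) //=.
apply: eq_bigr => j xj; rewrite -increment_push; apply: eq_bigl => i.
by case: (t i =P j) => [->|]; rewrite ?xj ?andbF.
Qed.

Definition label_weight (h : R -> R) (k : K) : EG R K -> R :=
  rlift (label_weight_simplex h k).

Lemma label_weightE (h : R -> R) (k : K) n (x : nerve (indiscrete_cat K) n) s :
  label_weight h k (rcell x s) = label_weight_simplex h k x s.
Proof. by rewrite /label_weight rliftE //; exact: label_weight_op. Qed.

Lemma label_weight_continuous (h : R -> R) (k : K) :
  continuous h -> continuous (label_weight h k).
Proof.
move=> ch; apply: rlift_continuous; first exact: label_weight_op.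
have cc n j : continuous (fun s : simplex R n => cumul s j).
  by apply: continuousT_sum => i _; exact: scoord_continuous.
move=> n x; apply: continuousT_sum => i _.
exact: (continuousT_sub (continuousT_comp ch (cc n i.+1))
  (continuousT_comp ch (cc n i))).
Qed.

Lemma label_weight_act (h : R -> R) (g k : K) (e : EG R K) :
  label_weight h (g * k)%g (kact g e) = label_weight h k e.
Proof.
have [n [x [s ->]]] := rcell_ex e.
rewrite /kact /= /realize_map realization_map_cell !label_weightE.
apply: eq_bigl => i /=; exact: (inj_eq (mulgI g)).
Qed.

Lemma label_weight_total (h : R -> R) (k k' : K) (e : EG R K) :
  {homo h : x y / x <= y} -> k != k' ->
  label_weight h k e + label_weight h k' e <= h 1 - h 0.
Proof.
move=> hmono kk'; have [n [x [s ->]]] := rcell_ex e; rewrite !label_weightE.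
rewrite -(scoord_sum s) -(@telescope_initial R n s h xpredT) //=.
rewrite [leRHS](bigID (fun i => fobj x i == k)) /= lerD2l.
rewrite [leRHS](bigID (fun i => fobj x i == k')) /=.
have -> : \sum_(i | (fobj x i != k) && (fobj x i == k'))
  (h (cumul s i.+1) - h (cumul s i)) = label_weight_simplex h k' x s.
  by apply: eq_bigl => i; case: eqP => // ->; rewrite (negbTE kk').
rewrite lerDl; apply: sumr_ge0 => i _; rewrite subr_ge0; apply: hmono.
by rewrite cumulS lerDl scoord_ge0.
Qed.

(** The window is a step of positive length of the step function of [e]. *)
Lemma EG_properly_discontinuous : properly_discontinuous (EG R K).
Proof.
move=> e; have [n [x [s es]]] := rcell_ex e.
have [i si] := scoord_pos s.
pose a := cumul s i; pose b := cumul s i.+1.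
have ab : b = a + scoord s i by exact: cumulS.
have a0 : 0 <= a by exact: cumul_ge0.
have b1 : b <= 1 by exact: cumul_le1.
(* increments of [h] are lengths inside the window from [a] to [b] *)
pose h z := Num.max a (Num.min z b).
have hmono : {homo h : x y / x <= y}.
  move=> y z yz; rewrite /h ge_max le_max lexx /= le_max.
  by apply/orP; right; rewrite le_min !ge_min yz lexx orbT.
have ha : h a = a by rewrite /h (min_idPl _) ?maxxx // ab lerDl ltW.
have hb : h b = b by rewrite /h minxx; apply/max_idPr; rewrite ab lerDl ltW.
have h0 : h 0 = a.
  by apply/max_idPl; rewrite ge_min a0.
have h1 : h 1 = b.
  by rewrite /h (min_idPr b1); apply/max_idPr; rewrite ab lerDl ltW.
have ch : continuous h.
  apply: continuousT_max; first exact: cst_continuous.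
  by apply: continuousT_min; [exact: id_continuous|exact: cst_continuous].
exists [set e' | (b - a) / 2 < label_weight h (fobj x i) e'].
have ba : 0 < b - a by rewrite ab addrAC subrr add0r.
split.
- have -> : [set e' | (b - a) / 2 < label_weight h (fobj x i) e'] =
    label_weight h (fobj x i) @^-1` [set z | (b - a) / 2 < z] by [].
  apply: open_comp => [y _|]; first exact: label_weight_continuous.
  exact: open_gt.
- rewrite /= es label_weightE /label_weight_simplex (bigD1 i) //= ha hb.
  set rest := \sum_(_ | _) _; have : 0 <= rest.
    apply: sumr_ge0 => j _; rewrite subr_ge0; apply: hmono.
    by rewrite cumulS lerDl scoord_ge0.
  by lra.
move=> k w /= Ww Wkw; apply/eqP/negPn/negP => k1.
have := Wkw; rewrite -[fobj x i](mulVKg k) label_weight_act => Wkw'.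
have : fobj x i != (k^-1 * fobj x i)%g.
  rewrite -(inj_eq (mulgI k)) mulVKg; apply: contra k1 => /eqP kx.
  by rewrite -(inj_eq (mulIg (fobj x i))) mul1g kx.
move=> /(label_weight_total w hmono); rewrite h1 h0.
(* two distinct labels cannot both fill more than half of the window *)
by move: Ww Wkw'; lra.
Qed.

End TotalSpace.

(** * The shrinking homotopy *)

Section Shrinking.
Variable R : realType.
Local Notation I := (@unit_interval R).

Section Weights.
Variables (T : eqType) (n : nat) (c : 'I_n.+1 -> T) (s : simplex R n).

(** The vertices of a simplex of a nerve may repeat: [vweight i] is the barycentric
    weight of the vertex [c i], all its occurrences together. *)
Definition vweight (i : 'I_n.+1) : R := \sum_(j | c j == c i) scoord s j.

(** The mean of the vertex weights, hence at most their maximum; it is a polynomial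
    in the coordinates. *)
Definition mean_weight : R := \sum_i scoord s i * vweight i.

(** The excess over half of the mean is positive for the heaviest vertex, and
    vanishes for vertices of small weight. *)
Definition excess (i : 'I_n.+1) : R := Num.max 0 (vweight i - mean_weight / 2).

Definition total_excess : R := \sum_i scoord s i * excess i.

Lemma vweight_ge i : scoord s i <= vweight i.
Proof.
rewrite /vweight (bigD1 i) //= lerDl.
by apply: sumr_ge0 => j _; exact: scoord_ge0.
Qed.

Lemma mean_weight_gt0 : 0 < mean_weight.
Proof.
have [i si] := scoord_pos s; rewrite /mean_weight (bigD1 i) //=.
apply: ltr_pwDl; last first.
  apply: sumr_ge0 => j _; apply: mulr_ge0; first exact: scoord_ge0.
  exact: le_trans (scoord_ge0 s j) (vweight_ge j).
by apply: mulr_gt0 => //; exact: lt_le_trans si (vweight_ge i).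
Qed.

Lemma excess_ge0 i : 0 <= excess i.
Proof. by rewrite le_max lexx. Qed.

Lemma total_excess_gt0 : 0 < total_excess.
Proof.
have m0 := mean_weight_gt0.
suff : mean_weight / 2 <= total_excess by lra.
have <- : \sum_i scoord s i * (vweight i - mean_weight / 2) = mean_weight / 2.
  under eq_bigr do rewrite mulrBr.
  by rewrite sumrB -mulr_suml scoord_sum -/mean_weight mul1r; lra.
apply: ler_sum => i _; apply: ler_wpM2l; first exact: scoord_ge0.
by rewrite le_max lexx orbT.
Qed.

(** At time 1 the coordinates are multiplied by the excess and normalized.  The
    factor depends on the vertex only, so the formula is compatible with faces and
    degeneracies. *)
Definition shrink_weight (t : R) (i : 'I_n.+1) : R :=
  scoord s i * (1 - t + t * (excess i / total_excess)).

Lemma shrink_weight_simplex (t : I) :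
  (forall i, 0 <= shrink_weight (val t) i) /\
  \sum_i shrink_weight (val t) i = 1.
Proof.
have t0 := unit_interval_ge0 t; have t1 := unit_interval_le1 t.
have e0 := total_excess_gt0; split=> [i|].
  apply: mulr_ge0; first exact: scoord_ge0.
  apply: addr_ge0; first by rewrite subr_ge0.
  by apply: mulr_ge0 => //; apply: divr_ge0; [exact: excess_ge0|exact: ltW].
have E i : shrink_weight (val t) i = (1 - val t) * scoord s i +
    val t / total_excess * (scoord s i * excess i).
  by rewrite /shrink_weight; ring.
under eq_bigr do rewrite E.
rewrite big_split /= -!mulr_sumr scoord_sum -/total_excess mulr1.
by rewrite divfK ?subrK // gt_eqF.
Qed.

Definition shrink (t : I) : simplex R n := mk_simplex (shrink_weight_simplex t).

Lemma shrinkE t i : scoord (shrink t) i = shrink_weight (val t) i.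
Proof. exact: mk_simplexE. Qed.

Lemma shrink0 t : val t = 0 -> shrink t = s.
Proof.
move=> t0; apply: simplex_eq => i.
by rewrite shrinkE /shrink_weight t0 subr0 mul0r addr0 mulr1.
Qed.

End Weights.

Section Push.
Variables (T : eqType) (m n : nat) (theta : 'I_m.+1 -> 'I_n.+1).
Variables (c : 'I_n.+1 -> T) (s : simplex R m).

Lemma vweight_push i :
  vweight (c \o theta) s i = vweight c (simplex_push theta s) (theta i).
Proof.
exact: (simplex_push_mass theta s (fun j => c j == c (theta i))).
Qed.

Lemma mean_weight_push :
  mean_weight (c \o theta) s = mean_weight c (simplex_push theta s).
Proof.
rewrite /mean_weight -(simplex_push_sum theta s _ xpredT).
by apply: eq_bigr => i _; rewrite vweight_push.
Qed.

Lemma shrink_push t :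
  simplex_push theta (shrink (c \o theta) s t) =
  shrink c (simplex_push theta s) t.
Proof.
have eE i : excess (c \o theta) s i = excess c (simplex_push theta s) (theta i).
  by rewrite /excess vweight_push mean_weight_push.
have tE : total_excess (c \o theta) s = total_excess c (simplex_push theta s).
  rewrite /total_excess -(simplex_push_sum theta s _ xpredT).
  by apply: eq_bigr => i _; rewrite eE.
apply: simplex_eq => j; rewrite simplex_pushE shrinkE /shrink_weight.
rewrite simplex_pushE mulr_suml; apply: eq_bigr => i /eqP <-.
by rewrite shrinkE /shrink_weight eE tE.
Qed.

End Push.

(** Shrinking sees a chain only through the coincidences between its vertices. *)
Lemma shrink_eq (T T' : eqType) n (c : 'I_n.+1 -> T) (c' : 'I_n.+1 -> T')
    (s : simplex R n) t : (forall i j, (c i == c j) = (c' i == c' j)) ->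
  shrink c s t = shrink c' s t.
Proof.
move=> cc'; have vE i : vweight c s i = vweight c' s i by exact: eq_bigl.
have mE : mean_weight c s = mean_weight c' s.
  by apply: eq_bigr => i _; rewrite vE.
have eE i : excess c s i = excess c' s i by rewrite /excess vE mE.
have tE : total_excess c s = total_excess c' s.
  by apply: eq_bigr => i _; rewrite eE.
by apply: simplex_eq => i; rewrite !shrinkE /shrink_weight eE tE.
Qed.

Lemma vweight_continuous (T : eqType) n (c : 'I_n.+1 -> T) i :
  continuous (fun s : simplex R n => vweight c s i).
Proof. by apply: continuousT_sum => j _; exact: scoord_continuous. Qed.

Lemma mean_weight_continuous (T : eqType) n (c : 'I_n.+1 -> T) :
  continuous (fun s : simplex R n => mean_weight c s).
Proof.
apply: continuousT_sum => j _; apply: continuousT_mul.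
  exact: scoord_continuous.
exact: vweight_continuous.
Qed.

Lemma excess_continuous (T : eqType) n (c : 'I_n.+1 -> T) i :
  continuous (fun s : simplex R n => excess c s i).
Proof.
apply: continuousT_max; first exact: cst_continuous.
apply: continuousT_sub; first exact: vweight_continuous.
by apply: continuousT_mul; [exact: mean_weight_continuous|exact: cst_continuous].
Qed.

Lemma shrink_continuous (T : eqType) n (c : 'I_n.+1 -> T) :
  continuous (fun z : simplex R n * I => shrink c z.1 z.2).
Proof.
apply: simplex_continuous => i; under eq_fun do rewrite shrinkE.
have cfst (f : simplex R n -> R) : continuous f ->
    continuous (fun z : simplex R n * I => f z.1).
  move=> cf; exact: (continuousT_comp cf (@fst_continuous _ _)).
have ct : continuous (fun z : simplex R n * I => val z.2 : R).
  exact: (continuousT_comp (@unit_interval_val_continuous R) (@snd_continuous _ _)).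
apply: continuousT_mul; first exact: (cfst _ (@scoord_continuous R n i)).
apply: continuousT_add.
  exact: (continuousT_sub (@cst_continuous _ _ (1 : R)) ct).
apply: continuousT_mul => //; apply: continuousT_mul.
  exact: (cfst _ (@excess_continuous T n c i)).
apply: continuousT_inv => [|z]; last by rewrite gt_eqF // total_excess_gt0.
apply: (cfst (total_excess c)); apply: continuousT_sum => j _.
by apply: continuousT_mul; [exact: scoord_continuous|exact: excess_continuous].
Qed.

End Shrinking.

(** * Homotopy colimits, cell by cell *)

Section HocolimPoints.
Context d (Q : porderType d) (R : realType) (X : diagram Q).

Definition hcell n (c : nerve (poset_cat Q) n) (x : X (c ord0))
    (s : simplex R n) : hocolim R X := ipi (@hocolim_rel d Q R X) (hocell x s).

Lemma hcell_op m n (t : {omorphism 'I_m.+1 -> 'I_n.+1})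
    (c : nerve (poset_cat Q) n) (x : X (c ord0)) (s : simplex R m) :
  hcell (c := sop t c) (@dmap _ _ X _ _ (chain_head c (t ord0)) x) s =
  hcell x (simplex_push t s).
Proof. by apply: ipi_eq; exact: HocolimRel. Qed.

Lemma hcell_eq n (b b' : nerve (poset_cat Q) n) (x : X (b ord0))
    (x' : X (b' ord0)) (s : simplex R n) :
  b = b' -> (forall h : (b ord0 <= b' ord0)%O, dmap h x = x') ->
  hcell x s = hcell x' s.
Proof.
by move=> e; case: _ / e x' => x' xx'; rewrite -(xx' (lexx _)) dmap1.
Qed.

Lemma hcell_ex (q : hocolim R X) :
  exists n (c : nerve (poset_cat Q) n) (x : X (c ord0)) s, q = hcell x s.
Proof. by have [[[n c] [x s]] <-] := ipi_surj q; exists n, c, x, s. Qed.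

Lemma hcell_continuous n (c : nerve (poset_cat Q) n) :
  continuous (fun z : X (c ord0) * simplex R n => hcell z.1 z.2).
Proof.
have -> : (fun z : X (c ord0) * simplex R n => hcell z.1 z.2) =
    ipi (@hocolim_rel d Q R X) \o
    existT (fun c : {classic {n & nerve (poset_cat Q) n}} =>
      X (projT2 c ord0) * simplex R (projT1 c))%type (existT _ n c).
  by apply/funext => -[].
apply: (@continuousT_comp _ _ _ (ipi (@hocolim_rel d Q R X))).
  exact: ipi_continuous.
exact: (@existT_continuous {classic {n & nerve (poset_cat Q) n}}
  (fun c => X (projT2 c ord0) * simplex R (projT1 c))%type (existT _ n c)).
Qed.

Lemma hocolim_continuous (Z : topologicalType) (f : hocolim R X -> Z) :
  (forall n (c : nerve (poset_cat Q) n),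
    continuous (fun z : X (c ord0) * simplex R n => f (hcell z.1 z.2))) ->
  continuous f.
Proof.
move=> cf; apply: identify_continuous.
apply: (@sigT_dep_continuous {classic {n & nerve (poset_cat Q) n}}
  (fun c => X (projT2 c ord0) * simplex R (projT1 c))%type) => -[n c].
rewrite [W in continuous W](_ : _ =
  (fun z : X (c ord0) * simplex R n => f (hcell z.1 z.2))).
  exact: cf.
by apply/funext => -[].
Qed.

Lemma hocolim_prod_continuous (V Z : topologicalType)
    (f : hocolim R X * V -> Z) :
  locally_compact [set: V] -> hausdorff_space V ->
  (forall n (c : nerve (poset_cat Q) n),
    continuous (fun z : X (c ord0) * simplex R n * V =>
      f (hcell z.1.1 z.1.2, z.2))) ->
  continuous f.
Proof.
move=> lV hV cf; apply: identify_prod_continuous => //.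
apply: (@sigT_prod_continuous {classic {n & nerve (poset_cat Q) n}}
  (fun c => X (projT2 c ord0) * simplex R (projT1 c))%type) => -[n c].
rewrite [W in continuous W](_ : _ =
  (fun z : X (c ord0) * simplex R n * V => f (hcell z.1.1 z.1.2, z.2))).
  exact: cf.
by apply/funext => -[[]].
Qed.

Section Lift.
Variables (Z : Type)
  (g : forall n (c : nerve (poset_cat Q) n), X (c ord0) -> simplex R n -> Z).
Hypothesis gE : forall m n (t : {omorphism 'I_m.+1 -> 'I_n.+1})
    (c : nerve (poset_cat Q) n) (x : X (c ord0)) (s : simplex R m),
  @g _ (sop t c) (@dmap _ _ X _ _ (chain_head c (t ord0)) x) s =
  g x (simplex_push t s).

Definition hlift (q : hocolim R X) : Z :=
  ilift (fun p : prehocolim R X => g (projT2 p).1 (projT2 p).2) q.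

Lemma hliftE n (c : nerve (poset_cat Q) n) (x : X (c ord0)) s :
  hlift (hcell x s) = g x s.
Proof. by rewrite /hlift /hcell iliftE // => _ _ [*]; exact: gE. Qed.

End Lift.

Definition hocolim_shrink (z : hocolim R X * @unit_interval R) : hocolim R X :=
  hlift (fun n c x s => hcell x (shrink (fobj c) s z.2)) z.1.

Lemma hocolim_shrinkE n (c : nerve (poset_cat Q) n) (x : X (c ord0)) s t :
  hocolim_shrink (hcell x s, t) = hcell x (shrink (fobj c) s t).
Proof.
rewrite /hocolim_shrink hliftE // => {n c x s} m n th c x s /=.
by rewrite hcell_op shrink_push.
Qed.

Lemma hocolim_shrink_continuous : continuous hocolim_shrink.
Proof.
apply: hocolim_prod_continuous.
- exact: unit_interval_locally_compact.
- exact: unit_interval_hausdorff.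
move=> n c; under eq_fun do rewrite hocolim_shrinkE.
have c1 : continuous (fun z : X (c ord0) * simplex R n * @unit_interval R => z.1.1).
  exact: (continuousT_comp (@fst_continuous _ _) (@fst_continuous _ _)).
have c2 : continuous (fun z : X (c ord0) * simplex R n * @unit_interval R => z.1.2).
  exact: (continuousT_comp (@snd_continuous _ _) (@fst_continuous _ _)).
have c3 := continuousT_pair c1 (continuousT_comp
  (@shrink_continuous R _ n (fobj c)) (continuousT_pair c2 (@snd_continuous _ _))).
exact: (continuousT_comp (@hcell_continuous n c) c3).
Qed.

Lemma hocolim_shrink0 q t : val t = 0 -> hocolim_shrink (q, t) = q.
Proof.
by move=> t0; have [n [c [x [s ->]]]] := hcell_ex q; rewrite hocolim_shrinkE shrink0.
Qed.

End HocolimPoints.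

(** * Realizations of discrete categories *)

Section Homotopies.
Variable R : realType.

Lemma homotopic_refl (X Y : topologicalType) (f : X -> Y) :
  continuous f -> homotopic R f f.
Proof.
move=> cf; exists (fun z => f z.1); split=> //.
exact: (continuousT_comp cf (@fst_continuous _ _)).
Qed.

Lemma homotopic_sym (X Y : topologicalType) (f g : X -> Y) :
  homotopic R f g -> homotopic R g f.
Proof.
move=> [H [cH H0 H1]].
exists (fun z => H (z.1, clamp (1 - val z.2))).
have flip (t : R) : 0 <= t -> t <= 1 -> clamp_fun t = t.
  by move=> t0 t1; rewrite /clamp_fun (min_idPl t1); exact/max_idPr.
split.
- apply: (continuousT_comp cH); apply: continuousT_pair; first exact: fst_continuous.
  have cs : continuous (fun z : X * @unit_interval R => 1 - val z.2).
    apply: continuousT_sub; first exact: cst_continuous.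
    exact: (continuousT_comp (@unit_interval_val_continuous R) (@snd_continuous _ _)).
  exact: (continuousT_comp (@clamp_continuous R) cs).
- by move=> x t t0; apply: H1; rewrite /= t0 subr0 flip.
- by move=> x t t1; apply: H0; rewrite /= t1 subrr flip.
Qed.

Lemma homeomorphic_homotopy_equivalent (X Y : topologicalType)
    (f : X -> Y) (g : Y -> X) :
  continuous f -> continuous g -> cancel f g -> cancel g f ->
  homotopy_equivalent R X Y.
Proof.
move=> cf cg fK gK; exists f, g; split => //.
- have -> : g \o f = id by apply/funext.
  exact: homotopic_refl (@id_continuous X).
- have -> : f \o g = id by apply/funext.
  exact: homotopic_refl (@id_continuous Y).
Qed.

End Homotopies.

Definition discrete_cat (T : Type) : category.
Proof.
refine (@Category T (fun x y => x = y) (fun _ => erefl)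
  (fun x y z (yz : y = z) (xy : x = y) => etrans xy yz) _ _ _).
- by move=> x y z t h g f; exact: Prop_irrelevance.
- by move=> x y; case: y /.
- by move=> x y; case: y /.
Defined.

Lemma discrete_hom_eq (T : Type) (x y : discrete_cat T) (f g : chom x y) : f = g.
Proof. exact: (@Prop_irrelevance (x = y :> T)). Qed.

Definition discrete_functor (T U : Type) (f : T -> U) :
  functor (discrete_cat T) (discrete_cat U).
Proof.
refine (@Functor (discrete_cat T) (discrete_cat U) f (fun x y => @congr1 T U f x y) _ _).
- by move=> x; exact: discrete_hom_eq.
- by move=> x y z g h; exact: discrete_hom_eq.
Defined.

Lemma discrete_functor_eq (C : category) (T : Type)
  (F G : functor C (discrete_cat T)) : fobj F =1 fobj G -> F = G.
Proof.
move=> /funext e; apply: (functor_eq (e := e)) => x y f.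
exact: discrete_hom_eq.
Qed.

Definition mk_omorphism m n (f : 'I_m.+1 -> 'I_n.+1)
    (fh : {homo f : x y / (x <= y)%O}) : {omorphism 'I_m.+1 -> 'I_n.+1} :=
  HB.pack f (Order.isOrderMorphism.Build _ _ _ _ f fh).

Lemma mk_omorphismE m n (f : 'I_m.+1 -> 'I_n.+1)
    (fh : {homo f : x y / (x <= y)%O}) i : mk_omorphism fh i = f i.
Proof. by []. Qed.

Section RealizeDiscrete.
Variables (R : realType) (T : choiceType).
Local Notation DT := (discrete_cat T).

Definition component : realize R DT -> T :=
  @rlift R (nerve DT) T (fun n x s => fobj x ord0).

Lemma component_cell n (x : nerve DT n) (s : simplex R n) :
  component (rcell x s) = fobj x ord0.
Proof.
rewrite /component rliftE // => {n x s} k m t x s.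
exact: (esym (fmap x (leq0n (t ord0) : @chom (poset_cat 'I_m.+1) ord0 (t ord0)))).
Qed.

Definition const_simplex n (a : T) : nerve DT n.
Proof.
refine (@Functor (poset_cat 'I_n.+1) DT (fun _ => a) (fun _ _ _ => erefl) _ _).
- by move=> x; exact: discrete_hom_eq.
- by move=> x y z g h; exact: discrete_hom_eq.
Defined.

Lemma simplex0_subproof : (forall i : 'I_1, 0 <= (1 : R)) /\ \sum_(i < 1) (1 : R) = 1.
Proof. by split=> [_|]; rewrite ?ler01 // big_ord1. Qed.

Definition simplex0 : simplex R 0 := mk_simplex simplex0_subproof.

Definition vertex (a : T) : realize R DT := @rcell R (nerve DT) 0 (const_simplex 0 a) simplex0.

Lemma vertexK : cancel vertex component.
Proof. by move=> a; rewrite component_cell. Qed.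

Lemma vertex_component : cancel component vertex.
Proof.
move=> y; have [n [x [s ->]]] := rcell_ex y; rewrite component_cell.
have hom0 : {homo (fun=> ord0) : i j / (i <= j :> 'I_n.+1)%O >-> (i <= j :> 'I_1)%O}.
  by [].
have -> : x = sop (mk_omorphism hom0) (const_simplex 0 (fobj x ord0)).
  apply: discrete_functor_eq => i /=.
  exact: (esym (fmap x (leq0n i : @chom (poset_cat 'I_n.+1) ord0 i))).
rewrite rcell_op; congr (rcell _ _); apply: simplex_eq => i.
rewrite simplex_pushE mk_simplexE (ord1 i) -[LHS](scoord_sum s).
by apply: eq_bigl => j; rewrite mk_omorphismE eqxx.
Qed.

Lemma component_continuous (Z : topologicalType) (g : T -> Z) :
  continuous (g \o component).
Proof.
apply: realization_continuous => n x.
under eq_fun do rewrite /= component_cell.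
exact: cst_continuous.
Qed.

Lemma component_near (y : realize R DT) :
  \forall y' \near y, component y' = component y.
Proof.
have := @component_continuous (discrete_topology T) id y [set component y].
by apply; exact: discrete_set1.
Qed.

(** A realized discrete category is discrete, so continuity may be checked with the
    component held fixed. *)
Lemma component_case_continuous (S Z : topologicalType) (u : S -> realize R DT)
    (g : S -> T -> Z) :
  continuous u -> (forall a, continuous (g^~ a)) ->
  continuous (fun z => g z (component (u z))).
Proof.
move=> cu cg z.
have near_z : \forall z' \near z, g z' (component (u z)) = g z' (component (u z')).
  have cz : \forall z' \near z, component (u z') = component (u z).
    exact: (cu z _ (component_near (u z))).
  by apply: filterS cz => z' ->.
by apply: near_eq_continuous near_z _; exact: cg.
Qed.

Lemma realize_discrete_homotopy_equivalent :
  homotopy_equivalent R (realize R DT) (discrete_topology T).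
Proof.
apply: (@homeomorphic_homotopy_equivalent _ _ (discrete_topology T) component vertex).
- exact: (@component_continuous (discrete_topology T) id).
- move=> a A aA.
  apply: (@filterS _ _ (nbhs_filter (a : discrete_topology T)) [set a]).
    by move=> _ -> /=; exact: nbhs_singleton.
  exact: discrete_set1.
- exact: vertex_component.
- exact: vertexK.
Qed.

End RealizeDiscrete.
Arguments vertex R {T} a.

Lemma realize_map_vertex (R : realType) (T U : choiceType) (f : T -> U) a :
  realize_map (discrete_functor f) (vertex R a) = vertex R (f a).
Proof.
rewrite /realize_map realization_map_cell; congr (rcell _ _).
exact: discrete_functor_eq.
Qed.

Lemma component_map (R : realType) (T U : choiceType) (f : T -> U) y :
  component (realize_map (R := R) (discrete_functor f) y) = f (component y).
Proof. by rewrite -{1}(vertex_component y) realize_map_vertex vertexK. Qed.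

(** * Chains of cosets *)

Section CosetDiagram.
Context d (Q : porderType d) (G : complex_of_groups Q) (K : groupType).
Variable c : cocone G K.

Lemma to_coset_ex q (A : cosets c q) : exists k, to_coset c k q = A.
Proof. by have [k _ kA] := set_mem (valP A); exists k; apply: val_inj. Qed.

Definition coset_rep q (A : cosets c q) : K := projT1 (boolp.cid (to_coset_ex A)).

Lemma coset_repK q : cancel (@coset_rep q) ((to_coset c)^~ q).
Proof. by move=> A; rewrite /coset_rep; case: boolp.cid. Qed.

Lemma to_coset_eqP k k' q :
  to_coset c k q = to_coset c k' q <-> range (c q) (k^-1 * k')%g.
Proof.
split=> [e|[h _ hE]].
  by apply: coset_elt_eq; rewrite /coset_elt e.
apply/val_inj/seteqP => /=; have -> : k' = (k * c q h)%g by rewrite hE mulVKg.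
split=> _ [_ [g _ <-] <-].
  exists (c q (h^-1 * g)%g); first by exists (h^-1 * g)%g.
  by rewrite -mulgA -gmulfM mulVKg.
exists (c q (h * g)%g); first by exists (h * g)%g.
by rewrite gmulfM mulgA.
Qed.

Definition coset_map p q (pq : (p <= q)%O) (A : cosets c p) : cosets c q :=
  to_coset c (coset_rep A) q.

Lemma coset_mapE p q (pq : (p <= q)%O) k :
  coset_map pq (to_coset c k p) = to_coset c k q.
Proof.
apply/to_coset_eqP.
have /to_coset_eqP [h _ hE] := coset_repK (to_coset c k p).
by exists (cg_map G pq h) => //; rewrite leg_map.
Qed.

Lemma coset_map1 p (pp : (p <= p)%O) A : coset_map pp A = A.
Proof. exact: coset_repK. Qed.

Lemma coset_mapM p q r (pq : (p <= q)%O) (qr : (q <= r)%O) (pr : (p <= r)%O) A :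
  coset_map pr A = coset_map qr (coset_map pq A).
Proof. by rewrite -(coset_repK A) !coset_mapE. Qed.

Definition coset_translate (k : K) q (A : cosets c q) : cosets c q :=
  exist (fun A => A \in cosets c q) _ (ltranslate_cosets k A).

Lemma coset_translateE k g q :
  coset_translate k (to_coset c g q) = to_coset c (k * g)%g q.
Proof. by apply: val_inj; exact: ltranslate_lcoset. Qed.

Lemma coset_translate1 q (A : cosets c q) : coset_translate 1%g A = A.
Proof. by rewrite -(coset_repK A) coset_translateE mul1g. Qed.

Lemma coset_translateM k g q (A : cosets c q) :
  coset_translate (k * g)%g A = coset_translate k (coset_translate g A).
Proof. by rewrite -(coset_repK A) !coset_translateE mulgA. Qed.

Lemma coset_map_translate k p q (pq : (p <= q)%O) (A : cosets c p) :
  coset_map pq (coset_translate k A) = coset_translate k (coset_map pq A).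
Proof. by rewrite -(coset_repK A) !(coset_translateE, coset_mapE). Qed.

Lemma coset_poset_leP (x y : coset_poset c) :
  (x <= y)%O <-> exists h : (tag x <= tag y)%O, coset_map h (tagged x) = tagged y.
Proof.
split=> [xy|[]].
  move: (xy); rewrite [X in is_true X -> _]le_eqVlt => /predU1P[->|].
    by exists (lexx _); exact: coset_map1.
  move=> /asboolP[k [q [k' [r [-> -> qr [g _ gE]]]]]] /=.
  by exists (ltW qr); rewrite coset_mapE; apply/to_coset_eqP; exists g.
case: x y => [q A] [r B] /= qr; rewrite -(coset_repK A) coset_mapE => <-.
move: (qr); rewrite le_eqVlt => /predU1P[e|lt_qr].
  by case: _ / e {qr}.
rewrite le_eqVlt; apply/orP; right; apply/asboolP.
exists (coset_rep A), q, (coset_rep A), r; split => //.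
by rewrite mulVg; exists 1%g => //; exact: mulmorph1.
Qed.

Lemma tag_homo : {homo (@tag Q (fun q => cosets c q : Type) : coset_poset c -> Q) :
  x y / (x <= y)%O}.
Proof. by move=> x y /coset_poset_leP[]. Qed.

Definition tag_functor : functor (poset_cat (coset_poset c)) (poset_cat Q).
Proof.
refine (@Functor (poset_cat (coset_poset c)) (poset_cat Q)
  (fun x => tag x) tag_homo _ _); by move=> *; exact: bool_irrelevance.
Defined.

Definition under_chain n (s : nerve (poset_cat (coset_poset c)) n) :
  nerve (poset_cat Q) n := functor_comp tag_functor s.

Lemma under_chain_op m n (t : {omorphism 'I_m.+1 -> 'I_n.+1})
    (s : nerve (poset_cat (coset_poset c)) n) :
  under_chain (sop t s) = sop t (under_chain s).
Proof. exact: functor_compA. Qed.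

Lemma lift_chain_homo n (b : nerve (poset_cat Q) n) (A : cosets c (b ord0))
    (i j : 'I_n.+1) : (i <= j)%O ->
  ((existT _ (b i) (coset_map (chain_head b i) A) : coset_poset c) <=
    (existT _ (b j) (coset_map (chain_head b j) A)))%O.
Proof.
move=> ij; apply/coset_poset_leP; exists (fmap b ij) => /=.
exact/esym/coset_mapM.
Qed.

(** Together with [under_chain], this identifies the chains of cosets with the pairs
    of a chain of [Q] and a coset over its least vertex. *)
Definition lift_chain n (b : nerve (poset_cat Q) n) (A : cosets c (b ord0)) :
  nerve (poset_cat (coset_poset c)) n.
Proof.
refine (@Functor (poset_cat 'I_n.+1) (poset_cat (coset_poset c))
  (fun i => existT _ (b i) (coset_map (chain_head b i) A))
  (@lift_chain_homo n b A) _ _); by move=> *; exact: bool_irrelevance.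
Defined.

Lemma lift_chainK n (b : nerve (poset_cat Q) n) (A : cosets c (b ord0)) :
  under_chain (lift_chain A) = b.
Proof. exact: poset_functor_eq. Qed.

Lemma lift_chain_head n (b : nerve (poset_cat Q) n) (A : cosets c (b ord0)) :
  tagged (lift_chain A ord0) = A.
Proof. exact: coset_map1. Qed.

Lemma chain_head_coset n (s : nerve (poset_cat (coset_poset c)) n) (i : 'I_n.+1)
    (h : (tag (s ord0) <= tag (s i))%O) :
  coset_map h (tagged (s ord0)) = tagged (s i).
Proof.
have [h' <-] := (coset_poset_leP _ _).1 (chain_head s i).
by rewrite (bool_irrelevance h h').
Qed.

Lemma under_chainK n (s : nerve (poset_cat (coset_poset c)) n) :
  @lift_chain n (under_chain s) (tagged (s ord0)) = s.
Proof.
apply: poset_functor_eq => i /=.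
rewrite (chain_head_coset (chain_head (under_chain s) i)) /=.
by case: (s i).
Qed.

Lemma lift_chain_op m n (t : {omorphism 'I_m.+1 -> 'I_n.+1})
    (b : nerve (poset_cat Q) n) (A : cosets c (b ord0)) :
  @lift_chain m (sop t b) (coset_map (chain_head b (t ord0)) A) =
  sop t (lift_chain A).
Proof.
apply: poset_functor_eq => i /=; congr (existT _ _ _).
exact/esym/coset_mapM.
Qed.

Lemma lift_chain_translate k n (b : nerve (poset_cat Q) n) (A : cosets c (b ord0)) :
  lift_chain (coset_translate k A) =
  functor_comp (poset_functor (coset_act (c := c) k)) (lift_chain A).
Proof.
apply: poset_functor_eq => i /=.
by rewrite /coset_act /=; congr (existT _ _ _); exact: coset_map_translate.
Qed.

Definition coset_cat (q : Q) : Kcat K.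
Proof.
refine (@KCat K (discrete_cat (cosets c q))
  (fun k => discrete_functor (@coset_translate k q)) _ _).
- apply: discrete_functor_eq => A; exact: coset_translate1.
- by move=> a b; apply: discrete_functor_eq => A; exact: coset_translateM.
Defined.

Definition coset_cat_map p q (pq : (p <= q)%O) :
  Kfunctor (coset_cat p) (coset_cat q).
Proof.
refine (@KFunctor K (coset_cat p) (coset_cat q)
  (discrete_functor (coset_map pq)) _).
by move=> k; apply: discrete_functor_eq => A; exact: coset_map_translate.
Defined.

Definition coset_diagram : Kcat_diagram Q K.
Proof.
refine (@KcatDiagram d Q K coset_cat coset_cat_map _ _).
- by move=> p pp; apply: discrete_functor_eq => A; exact: coset_map1.
- by move=> p q r pq qr pr; apply: discrete_functor_eq => A; exact: coset_mapM.
Defined.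

End CosetDiagram.

(** * Points carried by a chain *)

Lemma lift_homo n (i : 'I_n.+2) :
  {homo (fun j : 'I_n.+1 => lift i j) : x y / (x <= y)%O}.
Proof. by move=> x y xy; rewrite leEord /= leq_bump2. Qed.

Section PositiveRepresentative.
Variables (R : realType) (X : sset).

(** Vertices of weight zero are removed one at a time by faces. *)
Lemma positive_representative (x : realization R X) :
  exists n (a : X n) (s : simplex R n), x = rcell a s /\ forall i, 0 < scoord s i.
Proof.
have [n [a [s ->]]] := rcell_ex x.
elim: n a s => [|n IH] a s; have [s0|/existsNP [i si]] :=
  pselect (forall i, 0 < scoord s i).
- by exists 0, a, s.
- by case: si; have := scoord_sum s; rewrite big_ord1 (ord1 i) => ->.
- by exists n.+1, a, s.
have si0 : scoord s i = 0.
  by apply/eqP; rewrite eq_le scoord_ge0 andbT leNgt; exact/negP.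
have w01 : (forall j : 'I_n.+1, 0 <= scoord s (lift i j)) /\
    \sum_j scoord s (lift i j) = 1.
  split=> [j|]; first exact: scoord_ge0.
  by rewrite -(scoord_sum s) (bigD1_ord i) //= si0 add0r.
have [m [b [s' [E s'0]]]] := IH (sop (mk_omorphism (@lift_homo n i)) a) (mk_simplex w01).
exists m, b, s'; split => //; rewrite -E rcell_op; congr (rcell _ _).
apply: simplex_eq => j; rewrite simplex_pushE.
under eq_bigl do rewrite mk_omorphismE.
case: (unliftP i j) => [l ->|->].
  by under eq_bigl do rewrite (inj_eq lift_inj); rewrite big_pred1_eq mk_simplexE.
rewrite si0 big_pred0 // => l; rewrite eq_sym; exact/negbTE/neq_lift.
Qed.

End PositiveRepresentative.

Section Carrier.
Context (R : realType) d (P : porderType d).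
Local Notation NP := (nerve (poset_cat P)).
Local Notation RP := (realize R (poset_cat P)).

Definition mass (V : pred P) : RP -> R :=
  @rlift R NP R (fun n a s => \sum_(i | V (fobj a i)) scoord s i).

Lemma mass_cell (V : pred P) n (a : NP n) (s : simplex R n) :
  mass V (rcell a s) = \sum_(i | V (fobj a i)) scoord s i.
Proof.
rewrite /mass rliftE // => {n a s} m n t a s /=.
exact: (simplex_push_mass t s (fun j => V (fobj a j))).
Qed.

Lemma mass_continuous (V : pred P) : continuous (mass V).
Proof.
apply: realization_continuous => n a; under eq_fun do rewrite mass_cell.
by apply: continuousT_sum => i _; exact: scoord_continuous.
Qed.

Definition mean_mass : RP -> R :=
  @rlift R NP R (fun n a s => mean_weight (fobj a : 'I_n.+1 -> P) s).

Lemma mean_mass_cell n (a : NP n) (s : simplex R n) :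
  mean_mass (rcell a s) = mean_weight (fobj a : 'I_n.+1 -> P) s.
Proof.
rewrite /mean_mass rliftE // => {n a s} m n t a s; exact: mean_weight_push.
Qed.

Lemma mean_mass_continuous : continuous mean_mass.
Proof.
apply: realization_continuous => n a; under eq_fun do rewrite mean_mass_cell.
exact: mean_weight_continuous.
Qed.

Lemma mean_mass_gt0 x : 0 < mean_mass x.
Proof.
by have [n [a [s ->]]] := rcell_ex x; rewrite mean_mass_cell mean_weight_gt0.
Qed.

(** The weight of a repeated vertex of a chain is put on its first occurrence. *)
Definition first_occurrence n (a : NP n) (j : 'I_n.+1) : bool :=
  [forall i : 'I_n.+1, (fobj a i == fobj a j) ==> (j <= i)%N].

(** A point supported on the vertices of a chain is determined by their masses.  On a
    representative with positive weights, sending each vertex to its first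
    occurrence in [a] is monotone, because both chains are ordered by [P]. *)
Lemma carried_by_chain n (a : NP n) (x : RP) :
  mass (fun v => [forall i, fobj a i != v]) x = 0 ->
  exists2 s : simplex R n, x = rcell a s & forall j,
    scoord s j = if first_occurrence a j then mass (pred1 (fobj a j)) x else 0.
Proof.
have [m [b [w [-> w0]]]] := positive_representative x.
rewrite mass_cell => out0.
have inside i : exists j, fobj a j = fobj b i /\
    forall l, fobj a l = fobj b i -> (j <= l)%N.
  have [j0 j0b] : exists j, fobj a j == fobj b i.
    apply/existsP; apply: contraPT out0; rewrite negb_exists => bi.
    rewrite (bigD1 i) //=; apply/eqP; rewrite gt_eqF //; apply: ltr_pwDl => //.
    by apply: sumr_ge0 => l _; exact: scoord_ge0.
  case: (arg_minnP (P := fun j => fobj a j == fobj b i) (fun j : 'I_n.+1 => val j) j0b).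
  move=> j /eqP jb jmin; exists j; split => // l /eqP; exact: jmin.
have [t tP] := choice inside.
have t_homo : {homo t : x y / (x <= y)%O}.
  move=> i j ij; rewrite leEord leqNgt; apply/negP => tji.
  have [ti tmin] := tP i; have [tj tmin'] := tP j.
  have : (fobj b i <= fobj b j)%O by exact: (fmap b ij).
  have : (fobj b j <= fobj b i)%O.
    rewrite -ti -tj; exact: (fmap a (ltnW tji : @chom (poset_cat 'I_n.+1) _ _)).
  move=> ji ij'; have e : fobj b i = fobj b j by apply/le_anti; rewrite ij' ji.
  have := tmin (t j); rewrite tj e => /(_ erefl); by rewrite leqNgt tji.
have bE : b = sop (mk_omorphism t_homo) a.
  by apply: poset_functor_eq => i /=; have [-> _] := tP i.
exists (simplex_push (mk_omorphism t_homo) w); first by rewrite -rcell_op -bE.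
move=> j; rewrite simplex_pushE; case: ifPn => [fj|].
  rewrite mass_cell; apply: eq_bigl => i; rewrite mk_omorphismE /=.
  have [ti tmin] := tP i; apply/eqP/eqP => [<-|bj]; first by rewrite ti.
  apply/val_inj/eqP; rewrite eqn_leq tmin ?bj //=.
  by have /forallP/(_ (t i)) := fj; rewrite ti bj eqxx.
apply: contraNeq => sj; have [i ti] : exists i, t i == j.
  apply/existsP; apply: contraNT sj; rewrite negb_exists => /forallP nt.
  by apply/eqP; apply: big_pred0 => i; exact/negbTE/nt.
apply/forallP => l; apply/implyP => /eqP al; rewrite -(eqP ti).
by have [tb tmin] := tP i; apply: tmin; rewrite al -(eqP ti).
Qed.

(** Near a point of the simplex [a], the vertices outside [a] have total mass below
    half of the mean weight, so that shrinking removes them. *)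
Lemma shrink_carried_near n (a : NP n) (s : simplex R n) (t : @unit_interval R) :
  val t = 1 -> \forall y \near (rcell a s : RP), forall m (b : NP m) w, y = rcell b w ->
  mass (fun v => [forall i, fobj a i != v])
    (rcell b (shrink (fobj b : 'I_m.+1 -> P) w t)) = 0.
Proof.
move=> t1; set V := fun v : P => _; set x := rcell a s.
have x0 : mass V x = 0.
  rewrite /x mass_cell; apply: big_pred0 => i; apply/negbTE.
  by rewrite negb_forall; apply/existsP; exists i; rewrite negbK.
have m0 := mean_mass_gt0 x.
have near1 : \forall y \near x, mass V y < mean_mass x / 4.
  have := @mass_continuous V x; rewrite /continuous_at x0 => /cvgr_lt; apply.
  by rewrite divr_gt0.
have near2 : \forall y \near x, mean_mass x / 2 < mean_mass y.
  have := @mean_mass_continuous x => /cvgr_gt; apply; lra.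
apply: filterS2 near1 near2 => y + + m b w yE; rewrite yE mass_cell mean_mass_cell => y1 y2.
rewrite mass_cell; apply: big1 => i Vi; rewrite shrinkE /shrink_weight t1.
rewrite subrr add0r mul1r /excess (max_idPl _) ?mul0r ?mulr0 // subr_le0.
suff : vweight (fobj b : 'I_m.+1 -> P) w i <= \sum_(i | V (fobj b i)) scoord w i by lra.
rewrite [leRHS](bigID (fun j => fobj b j == fobj b i)) /=.
rewrite /vweight (eq_bigl (fun j => V (fobj b j) && (fobj b j == fobj b i))).
  by rewrite lerDl; apply: sumr_ge0 => j _; exact: scoord_ge0.
by move=> j; case: (fobj b j =P fobj b i) => [->|]; rewrite ?Vi ?andbF.
Qed.

End Carrier.

(** * The coset poset as a homotopy colimit *)

Section CosetRealization.
Context (R : realType) d (Q : porderType d) (G : complex_of_groups Q).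
Context (K : groupType).
Variable c : cocone G K.
Local Notation RP := (realize R (poset_cat (coset_poset c))).
Local Notation NP := (nerve (poset_cat (coset_poset c))).
Local Notation F := (coset_diagram c).
Local Notation I := (@unit_interval R).

(** The coset poset maps to the homotopy colimit of any diagram [X] that receives
    the diagram of cosets; below, [X] is its realization and then its Borel
    construction, along a point of [EK]. *)
Section Spread.
Variables (X : diagram Q) (u : forall q, cosets c q -> X q).
Hypothesis uE : forall p q (pq : (p <= q)%O) A,
  dmap pq (u A) = u (coset_map pq A).

Definition spread : RP -> hocolim R X :=
  @rlift R NP _ (fun n a s => hcell (c := under_chain a) (u (tagged (fobj a ord0))) s).

Lemma spread_cell n (a : NP n) (s : simplex R n) :
  spread (rcell a s) = hcell (c := under_chain a) (u (tagged (fobj a ord0))) s.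
Proof.
rewrite /spread rliftE // => {n a s} m n t a s; rewrite -hcell_op.
apply: hcell_eq; first exact: under_chain_op.
move=> h; rewrite !uE; congr (u _).
rewrite coset_map1; exact/esym/(chain_head_coset (i := t ord0)).
Qed.

Lemma spread_lift n (b : nerve (poset_cat Q) n) (A : cosets c (b ord0))
    (s : simplex R n) :
  spread (rcell (lift_chain A) s) = hcell (u A) s.
Proof.
rewrite spread_cell; apply: hcell_eq; first exact: lift_chainK.
by move=> h; rewrite uE lift_chain_head coset_map1.
Qed.

Lemma spread_continuous : continuous spread.
Proof.
apply: realization_continuous => n a; under eq_fun do rewrite spread_cell.
exact: (continuousT_comp (@hcell_continuous _ _ _ X n (under_chain a))
  (continuousT_pair (@cst_continuous _ _ (u (tagged (fobj a ord0))))
     (@id_continuous (simplex R n)))).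
Qed.

End Spread.

Lemma vertex_natural p q (pq : (p <= q)%O) (A : cosets c p) :
  @dmap _ _ (realize_diagram R F) _ _ pq (vertex R A) = vertex R (coset_map pq A).
Proof. exact: realize_map_vertex. Qed.

Definition to_hocolim : RP -> hocolim R (realize_diagram R F) :=
  spread (X := realize_diagram R F) (fun q => @vertex R (cosets c q)).

Lemma to_hocolim_cell n (a : NP n) (s : simplex R n) :
  to_hocolim (rcell a s) = @hcell _ _ R (realize_diagram R F) n (under_chain a)
    (vertex R (tagged (fobj a ord0))) s.
Proof. exact: (spread_cell vertex_natural). Qed.

Lemma to_hocolim_lift n (b : nerve (poset_cat Q) n) (A : cosets c (b ord0))
    (s : simplex R n) :
  to_hocolim (rcell (lift_chain A) s) =
  @hcell _ _ R (realize_diagram R F) n b (vertex R A) s.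
Proof. exact: (spread_lift vertex_natural). Qed.

Lemma to_hocolim_continuous : continuous to_hocolim.
Proof. exact: (spread_continuous vertex_natural). Qed.

Definition of_hocolim : hocolim R (realize_diagram R F) -> RP :=
  hlift (X := realize_diagram R F) (fun n b y s =>
    @rcell R NP n (lift_chain (@component R (cosets c (fobj b ord0)) y)) s).

Lemma of_hocolim_cell n (b : nerve (poset_cat Q) n)
    (y : realize_diagram R F (b ord0)) (s : simplex R n) :
  of_hocolim (hcell y s) =
  @rcell R NP n (lift_chain (@component R (cosets c (fobj b ord0)) y)) s.
Proof.
rewrite /of_hocolim hliftE // => {n b y s} m n t b y s.
by rewrite component_map -rcell_op -lift_chain_op.
Qed.

Lemma of_hocolim_vertex n (b : nerve (poset_cat Q) n)
    (A : cosets c (b ord0)) (s : simplex R n) :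
  of_hocolim (@hcell _ _ R (realize_diagram R F) n b (vertex R A) s) =
  @rcell R NP n (lift_chain A) s.
Proof. by rewrite of_hocolim_cell vertexK. Qed.

Lemma of_hocolim_continuous : continuous of_hocolim.
Proof.
apply: hocolim_continuous => n b; under eq_fun do rewrite of_hocolim_cell.
apply: (@component_case_continuous R (cosets c (fobj b ord0)) _ _ fst
  (fun z A => @rcell R NP n (lift_chain A) z.2)).
  exact: fst_continuous.
move=> A; exact: (continuousT_comp (@rcell_continuous R NP n _) (@snd_continuous _ _)).
Qed.

Lemma to_hocolimK : cancel to_hocolim of_hocolim.
Proof.
move=> x; have [n [a [s ->]]] := rcell_ex x.
by rewrite to_hocolim_cell of_hocolim_vertex under_chainK.
Qed.

Lemma of_hocolimK : cancel of_hocolim to_hocolim.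
Proof.
move=> q; have [n [b [y [s ->]]]] := hcell_ex q.
rewrite of_hocolim_cell to_hocolim_lift.
by rewrite (@vertex_component R (cosets c (fobj b ord0))).
Qed.

Lemma coset_poset_hocolim :
  homotopy_equivalent R RP (hocolim R (realize_diagram R F)).
Proof.
apply: (homeomorphic_homotopy_equivalent R _ of_hocolim_continuous
  to_hocolimK of_hocolimK).
exact: to_hocolim_continuous.
Qed.

Definition coset_shrink (z : RP * I) : RP :=
  of_hocolim (hocolim_shrink (to_hocolim z.1, z.2)).

Lemma coset_shrink_continuous : continuous coset_shrink.
Proof.
apply: (continuousT_comp of_hocolim_continuous).
apply: (continuousT_comp (@hocolim_shrink_continuous _ _ _ _)).
apply: continuousT_pair; last exact: snd_continuous.
exact: (continuousT_comp (to_hocolim_continuous) (@fst_continuous _ _)).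
Qed.

(** Comparable cosets over the same element of [Q] are equal, so shrinking above and
    below agree. *)
Lemma under_chain_pattern n (a : NP n) i j :
  (under_chain a i == under_chain a j) = (fobj a i == fobj a j).
Proof.
apply/eqP/eqP => [e|e]; last exact: (congr1 (fun x => tag x) e).
have H (k l : 'I_n.+1) : (k <= l)%O -> under_chain a k = under_chain a l ->
    fobj a k = fobj a l.
  move=> kl; have /coset_poset_leP : (fobj a k <= fobj a l)%O := fmap a kl.
  rewrite /=; case: (fobj a k) (fobj a l) => [p A] [q B] /= [pq <-] e'.
  by case: _ / e' pq => pq; rewrite coset_map1.
have /orP[ij|ji] := le_total i j; first exact: H.
by apply/esym/H.
Qed.

Lemma coset_shrinkE n (a : NP n) (s : simplex R n) t :
  coset_shrink (rcell a s, t) =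
  rcell a (shrink (fobj a : 'I_n.+1 -> coset_poset c) s t).
Proof.
rewrite /coset_shrink [X in hocolim_shrink (X, _)]to_hocolim_cell.
rewrite hocolim_shrinkE of_hocolim_vertex under_chainK.
rewrite (@shrink_eq R Q (coset_poset c) n (fobj (under_chain a)) (fobj a)) //.
exact: under_chain_pattern.
Qed.

End CosetRealization.

(** * The Borel construction of the coset poset *)

Section BorelHocolim.
Context (R : realType) d (Q : porderType d) (G : complex_of_groups Q).
Context (K : groupType).
Variable c : cocone G K.
Local Notation RP := (realize R (poset_cat (coset_poset c))).
Local Notation NP := (nerve (poset_cat (coset_poset c))).
Local Notation F := (coset_diagram c).
Local Notation I := (@unit_interval R).
Local Notation E := (EG R K).
Local Notation PK := (realizeK R (coset_Kcat c)).
Local Notation CK q := (realizeK R (coset_cat c q)).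
Local Notation BX := (borel_diagram R F).

Definition borel_vertex (e : E) q (A : cosets c q) : BX q :=
  @orbit_pi K (prod_Kspace E (CK q)) (e, vertex R A).

Lemma borel_vertex_natural e p q (pq : (p <= q)%O) (A : cosets c p) :
  @dmap _ _ BX _ _ pq (borel_vertex e A) = borel_vertex e (coset_map pq A).
Proof.
apply: (etrans (orbit_mapE (prod_Kmap E (realizeK_map R (kdmap F pq))) (e, vertex R A))).
exact: (congr1 (fun y => @orbit_pi K (prod_Kspace E (CK q)) (e, y))
  (realize_map_vertex R (coset_map pq) A)).
Qed.

Lemma borel_vertex_act k e q (A : cosets c q) :
  borel_vertex (kact k e) (coset_translate k A) = borel_vertex e A.
Proof.
apply/esym/(@orbit_pi_eqP K (prod_Kspace E (CK q))); exists k.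
congr (_, _); apply/esym; exact: realize_map_vertex.
Qed.

Lemma borel_vertex_ex q (z : BX q) : exists e A, z = @borel_vertex e q A.
Proof.
have [[e y] <-] := ipi_surj z; exists e, (component y).
by rewrite /borel_vertex vertex_component.
Qed.

Lemma borel_vertex_continuous q (A : cosets c q) :
  continuous (fun e => borel_vertex e A).
Proof.
exact: (continuousT_comp (@orbit_pi_continuous K (prod_Kspace E (CK q)))
  (continuousT_pair (@id_continuous E) (@cst_continuous E (CK q) (vertex R A)))).
Qed.

Lemma coset_act_cell k n (a : NP n) (s : simplex R n) :
  @kact K PK k (rcell a s) =
  @rcell R NP n (functor_comp (poset_functor (coset_act (c := c) k)) a) s.
Proof. exact: realization_map_cell. Qed.

Definition collect_cell n (b : nerve (poset_cat Q) n) (z : BX (b ord0))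
    (s : simplex R n) : borel R PK :=
  ilift (fun p : prod_Kspace E (CK (b ord0)) =>
    @orbit_pi K (prod_Kspace E PK)
      (p.1, @rcell R NP n (lift_chain (component p.2)) s)) z.

Lemma collect_cellE n (b : nerve (poset_cat Q) n) e y (s : simplex R n) :
  @collect_cell n b (@orbit_pi K (prod_Kspace E (CK (b ord0))) (e, y)) s =
  @orbit_pi K (prod_Kspace E PK) (e, @rcell R NP n (lift_chain (component y)) s).
Proof.
rewrite /collect_cell /orbit_pi iliftE // => {e y} -[e y] _ [k ->].
apply/(@orbit_pi_eqP K (prod_Kspace E PK)); exists k.
suff H : @rcell R NP n (lift_chain (component (@kact K (CK (b ord0)) k y))) s =
    @kact K PK k (rcell (lift_chain (component y)) s).
  exact: (congr1 (fun x : PK => (kact k e, x)) H).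
rewrite coset_act_cell -lift_chain_translate.
congr (rcell (lift_chain _) s).
exact: (component_map (@coset_translate _ _ _ _ c k (fobj b ord0)) y).
Qed.

Lemma collect_cell_vertex n (b : nerve (poset_cat Q) n) e (A : cosets c (b ord0))
    (s : simplex R n) :
  collect_cell (borel_vertex e A) s =
  @orbit_pi K (prod_Kspace E PK) (e, @rcell R NP n (lift_chain A) s).
Proof. by rewrite collect_cellE vertexK. Qed.

Lemma collect_cell_continuous n (b : nerve (poset_cat Q) n) :
  continuous (fun z : BX (b ord0) * simplex R n => collect_cell z.1 z.2).
Proof.
apply: (@orbit_prod_continuous K (prod_Kspace E (CK (b ord0))) (simplex R n)).
rewrite [W in continuous W](_ : _ =
  (fun z : prod_Kspace E (CK (b ord0)) * simplex R n =>
    @orbit_pi K (prod_Kspace E PK)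
      (z.1.1, @rcell R NP n (lift_chain (component z.1.2)) z.2))); last first.
  by apply/funext => -[[e y] s]; exact: (collect_cellE e y s).
have c1 : continuous (fun z : prod_Kspace E (CK (b ord0)) * simplex R n => z.1.2).
  exact: (continuousT_comp (@snd_continuous _ _) (@fst_continuous _ _)).
apply: (component_case_continuous (g := fun z A =>
  @orbit_pi K (prod_Kspace E PK) (z.1.1, @rcell R NP n (lift_chain A) z.2)) c1).
move=> A.
have c2 : continuous (fun z : prod_Kspace E (CK (b ord0)) * simplex R n => z.1.1).
  exact: (continuousT_comp (@fst_continuous _ _) (@fst_continuous _ _)).
exact: (continuousT_comp (@orbit_pi_continuous K (prod_Kspace E PK))
  (continuousT_pair c2 (continuousT_comp (@rcell_continuous R NP n (lift_chain A))
    (@snd_continuous _ _)))).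
Qed.

(** The comparison of the homotopy colimit of the Borel constructions with the Borel
    construction of the homotopy colimit. *)
Definition collect : hocolim R BX -> borel R PK :=
  hlift (X := BX) collect_cell.

Lemma collect_hcell n (b : nerve (poset_cat Q) n) (z : BX (b ord0)) s :
  collect (hcell z s) = collect_cell z s.
Proof.
rewrite /collect hliftE // => {n b z s} m n t b z s.
have [e [A ->]] := borel_vertex_ex z.
rewrite borel_vertex_natural !collect_cell_vertex -rcell_op.
exact: (congr1 (fun a => @orbit_pi K (prod_Kspace E PK) (e, @rcell R NP m a s))
  (lift_chain_op t A)).
Qed.

Lemma collect_continuous : continuous collect.
Proof.
apply: hocolim_continuous => n b; under eq_fun do rewrite collect_hcell.
exact: collect_cell_continuous.
Qed.

Definition slice_to_hocolim (e : E) : RP -> hocolim R BX :=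
  spread (X := BX) (@borel_vertex e).

Lemma slice_to_hocolim_cell e n (a : NP n) (s : simplex R n) :
  slice_to_hocolim e (rcell a s) = @hcell _ _ R BX n (under_chain a)
    (borel_vertex e (tagged (fobj a ord0))) s.
Proof. exact: (spread_cell (borel_vertex_natural e)). Qed.

Lemma slice_to_hocolim_lift e n (b : nerve (poset_cat Q) n)
    (A : cosets c (b ord0)) (s : simplex R n) :
  slice_to_hocolim e (rcell (lift_chain A) s) =
  @hcell _ _ R BX n b (borel_vertex e A) s.
Proof. exact: (spread_lift (borel_vertex_natural e)). Qed.

Lemma slice_to_hocolim_act k e (x : PK) :
  slice_to_hocolim (kact k e) (kact k x) = slice_to_hocolim e x.
Proof.
have [n [a [s ->]]] := rcell_ex x.
rewrite -(under_chainK a) coset_act_cell -lift_chain_translate.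
by rewrite !slice_to_hocolim_lift borel_vertex_act.
Qed.

Lemma collect_slice e x :
  collect (slice_to_hocolim e x) = @orbit_pi K (prod_Kspace E PK) (e, x).
Proof.
have [n [a [s ->]]] := rcell_ex x.
rewrite -(under_chainK a) slice_to_hocolim_lift collect_hcell.
exact: collect_cell_vertex.
Qed.

(** The inverse of [collect] as a map of sets, in general not continuous. *)
Definition distribute : borel R PK -> hocolim R BX :=
  ilift (fun p : prod_Kspace E PK => slice_to_hocolim p.1 p.2).

Lemma distributeE e x :
  distribute (@orbit_pi K (prod_Kspace E PK) (e, x)) = slice_to_hocolim e x.
Proof.
rewrite /distribute /orbit_pi iliftE // => {e x} -[e x] _ [k ->].
exact/esym/slice_to_hocolim_act.
Qed.

Lemma collectK : cancel collect distribute.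
Proof.
move=> q; have [n [b [z [s ->]]]] := hcell_ex q.
have [e [A ->]] := borel_vertex_ex z.
by rewrite collect_hcell collect_cell_vertex distributeE slice_to_hocolim_lift.
Qed.

Lemma hocolim_shrink_slice e x t :
  hocolim_shrink (slice_to_hocolim e x, t) = slice_to_hocolim e (coset_shrink (x, t)).
Proof.
have [n [a [s ->]]] := rcell_ex x.
rewrite coset_shrinkE !slice_to_hocolim_cell hocolim_shrinkE.
by congr hcell; apply: shrink_eq => i j; exact: under_chain_pattern.
Qed.

Definition interval_end : I := clamp 1.

Lemma interval_endE : val interval_end = 1.
Proof. by rewrite /= /clamp_fun minxx; exact/max_idPr. Qed.

(** Near a point of the simplex [a] the shrunk point lies on [a], and its coordinates
    there are masses, hence continuous; so the map factors through the single cell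
    of [a]. *)
Lemma shrunk_slice_continuous :
  continuous (fun z : E * RP => slice_to_hocolim z.1 (coset_shrink (z.2, interval_end))).
Proof.
move=> [e0 x0]; have [n [a [s x0E]]] := rcell_ex x0.
pose ret (x : RP) : RP := coset_shrink (x, interval_end).
have cret : continuous ret.
  exact: (continuousT_comp (@coset_shrink_continuous R _ _ _ _ c)
    (continuousT_pair (@id_continuous RP) (@cst_continuous _ _ interval_end))).
have near_a : \forall x \near x0, mass (fun v => [forall i, fobj a i != v]) (ret x) = 0.
  rewrite x0E; apply: filterS (shrink_carried_near a s interval_endE) => x xP.
  by have [m [b [w xE]]] := rcell_ex x; rewrite /ret xE coset_shrinkE; exact: xP.
have coords (x : RP) : exists w : simplex R n,
    mass (fun v => [forall i, fobj a i != v]) (ret x) = 0 ->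
    ret x = rcell a w /\ forall j,
    scoord w j = if first_occurrence a j then mass (pred1 (fobj a j)) (ret x) else 0.
  have [/carried_by_chain[w ? ?]|] := pselect (mass (fun v => [forall i, fobj a i != v]) (ret x) = 0).
    by exists w.
  by exists s.
have [w wP] := choice coords.
have cw : {for x0, continuous w}.
  apply: simplex_continuous_at => j.
  have wj : \forall x \near x0,
      (if first_occurrence a j then mass (pred1 (fobj a j)) (ret x) else 0) = scoord (w x) j.
    by apply: filterS near_a => x /wP[_ ->].
  apply: near_eq_continuous wj _.
  case: (first_occurrence a j); last exact: (@cst_continuous RP R (0 : R)).
  exact: (continuousT_comp (@mass_continuous R _ _ (pred1 (fobj a j))) cret).
have near_w : \forall z \near (e0, x0),
    @hcell _ _ R BX n (under_chain a) (borel_vertex z.1 (tagged (fobj a ord0))) (w z.2) =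
    slice_to_hocolim z.1 (ret z.2).
  have near_a2 : \forall z \near (e0, x0),
      mass (fun v => [forall i, fobj a i != v]) (ret z.2) = 0.
    exact: (@snd_continuous E RP (e0, x0) _ near_a).
  apply: filterS near_a2 => -[e x] out0; have [retx _] := wP x out0.
  exact/esym/(etrans (congr1 (slice_to_hocolim e) retx)
    (slice_to_hocolim_cell e a (w x))).
apply: near_eq_continuous near_w _.
have c1 := continuousT_comp (@borel_vertex_continuous _ (tagged (fobj a ord0)))
  (@fst_continuous E RP) : continuous _.
have c2 : {for (e0, x0), continuous (fun z : E * RP => w z.2)}.
  by apply: (@continuous_comp _ _ _ snd w); [exact: snd_continuous|exact: cw].
have c3 := continuous_at_pair (c1 (e0, x0)) c2.
exact: (continuous_comp c3 (@hcell_continuous _ _ R BX n (under_chain a) _)).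
Qed.

Lemma borel_hocolim : homotopy_equivalent R (borel R PK) (hocolim R BX).
Proof.
exists (fun z => hocolim_shrink (distribute z, interval_end)), collect; split.
- apply: identify_continuous.
  rewrite [W in continuous W](_ : _ = fun z : E * RP =>
    slice_to_hocolim z.1 (coset_shrink (z.2, interval_end))).
    exact: shrunk_slice_continuous.
  apply/funext => -[e x].
  exact: (etrans (congr1 (fun q => hocolim_shrink (q, interval_end)) (distributeE e x))
    (hocolim_shrink_slice e x interval_end)).
- exact: collect_continuous.
- apply: homotopic_sym.
  exists (fun z => collect (hocolim_shrink (distribute z.1, z.2))); split.
  + apply: orbit_prod_continuous.
    rewrite [W in continuous W](_ : _ = fun z : prod_Kspace E PK * I =>
      @orbit_pi K (prod_Kspace E PK) (z.1.1, coset_shrink (z.1.2, z.2))); last first.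
      apply/funext => -[[e x] t].
      exact: (etrans (congr1 (fun q => collect (hocolim_shrink (q, t))) (distributeE e x))
        (etrans (congr1 collect (hocolim_shrink_slice e x t)) (collect_slice e _))).
    have c1 : continuous (fun z : prod_Kspace E PK * I => z.1.1).
      exact: (continuousT_comp (@fst_continuous _ _) (@fst_continuous _ _)).
    have c2 : continuous (fun z : prod_Kspace E PK * I => z.1.2).
      exact: (continuousT_comp (@snd_continuous _ _) (@fst_continuous _ _)).
    have c3 : continuous (fun z : PK * I => coset_shrink z : PK).
      exact: coset_shrink_continuous.
    have c4 := continuousT_pair c1
      (continuousT_comp c3 (continuousT_pair c2 (@snd_continuous _ _))).
    exact: (continuousT_comp (@orbit_pi_continuous K (prod_Kspace E PK)) c4).
  + move=> z t t0; have [[e x] <-] := ipi_surj z.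
    by rewrite hocolim_shrink0 // -/(orbit_pi _) distributeE collect_slice.
  + move=> z t t1; have -> // : t = interval_end.
    by apply: val_inj; rewrite t1 interval_endE.
- apply: homotopic_sym.
  exists (@hocolim_shrink _ _ R BX); split.
  + exact: hocolim_shrink_continuous.
  + by move=> q t; exact: hocolim_shrink0.
  + move=> q t t1; have -> : t = interval_end by apply: val_inj; rewrite t1 interval_endE.
    exact: (congr1 (fun q => hocolim_shrink (q, interval_end)) (esym (collectK q))).
Qed.

End BorelHocolim.

(** * Homotopies by joins *)

Section Join.
Variable R : realType.
Local Notation I := (@unit_interval R).
Local Notation RI A := (realize R (indiscrete_cat A)).
Local Notation NI A := (nerve (indiscrete_cat A)).

Definition tuple_simplex (B : Type) n (w : 'I_n.+1 -> B) : NI B n :=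
  @Functor (poset_cat 'I_n.+1) (indiscrete_cat B) w (fun _ _ _ => tt)
    (fun _ => erefl) (fun _ _ _ _ _ => erefl).

Definition join_fun (B : Type) n (u v : 'I_n.+1 -> B) (i : 'I_(n.+1 + n.+1)) : B :=
  match fintype.split i with inl j => u j | inr j => v j end.

Lemma join_funl (B : Type) n (u v : 'I_n.+1 -> B) j :
  join_fun u v (lshift n.+1 j) = u j.
Proof. by rewrite /join_fun; case: split_ordP => l; [move/lshift_inj<-|move/eqP; rewrite eq_lrshift]. Qed.

Lemma join_funr (B : Type) n (u v : 'I_n.+1 -> B) j :
  join_fun u v (rshift n.+1 j) = v j.
Proof. by rewrite /join_fun; case: split_ordP => l; [move/eqP; rewrite eq_rlshift|move/rshift_inj<-]. Qed.

(** The two copies of a simplex that span the join share its weights in the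
    proportion [1 - t] to [t]. *)
Lemma join_weight_subproof n (s : simplex R n) (t : I) :
  let w := @join_fun R n (fun i => (1 - val t) * scoord s i)
    (fun i => val t * scoord s i) in
  (forall i, 0 <= w i) /\ \sum_i w i = 1.
Proof.
have t0 := unit_interval_ge0 t; have t1 := unit_interval_le1 t.
split=> [i|].
  rewrite /join_fun; case: fintype.split => j; apply: mulr_ge0 => //; last exact: scoord_ge0.
    by rewrite subr_ge0.
  exact: scoord_ge0.
rewrite (@big_split_ord _ _ _ n.+1 n.+1) /=.
under eq_bigr do rewrite join_funl; under [X in _ + X]eq_bigr do rewrite join_funr.
by rewrite -!mulr_sumr scoord_sum !mulr1 subrK.
Qed.

Definition join_weight n (s : simplex R n) (t : I) : simplex R (n + n.+1) :=
  @mk_simplex R (n + n.+1) _ (join_weight_subproof s t).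

Lemma join_weightE n (s : simplex R n) (t : I) i :
  scoord (join_weight s t) i = @join_fun R n (fun i => (1 - val t) * scoord s i)
    (fun i => val t * scoord s i) i.
Proof. exact: mk_simplexE. Qed.

Lemma join_weight_continuous n :
  continuous (fun z : simplex R n * I => join_weight z.1 z.2).
Proof.
apply: simplex_continuous => i; under eq_fun do rewrite join_weightE.
have ct : continuous (fun z : simplex R n * I => val z.2 : R).
  exact: (continuousT_comp (@unit_interval_val_continuous R) (@snd_continuous _ _)).
have cs j : continuous (fun z : simplex R n * I => scoord z.1 j).
  exact: (continuousT_comp (@scoord_continuous R n j) (@fst_continuous _ _)).
rewrite /join_fun; case: fintype.split => j; apply: continuousT_mul => //.
exact: (continuousT_sub (@cst_continuous _ _ (1 : R)) ct).
Qed.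

Definition join_op m n (t : 'I_m.+1 -> 'I_n.+1) :
    'I_(m.+1 + m.+1) -> 'I_(n.+1 + n.+1) :=
  join_fun (fun i => lshift n.+1 (t i)) (fun i => rshift n.+1 (t i)).

Lemma join_opl m n (t : 'I_m.+1 -> 'I_n.+1) k :
  join_op t (lshift m.+1 k) = lshift n.+1 (t k).
Proof. exact: join_funl. Qed.

Lemma join_opr m n (t : 'I_m.+1 -> 'I_n.+1) k :
  join_op t (rshift m.+1 k) = rshift n.+1 (t k).
Proof. exact: join_funr. Qed.

Lemma join_op_homo m n (t : {omorphism 'I_m.+1 -> 'I_n.+1}) :
  {homo (join_op t : 'I_(m + m.+1).+1 -> 'I_(n + n.+1).+1) : x y / (x <= y)%O}.
Proof.
move=> x y; rewrite /join_op /join_fun !leEord.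
case: (split_ordP (x : 'I_(m.+1 + m.+1))) => i -> /=;
  case: (split_ordP (y : 'I_(m.+1 + m.+1))) => j -> /= ij.
- exact: (omorph_le t ij).
- by apply: leq_trans (ltnW (ltn_ord _)) (leq_addr _ _).
- by move: ij; rewrite leqNgt (leq_trans (ltn_ord j) (leq_addr _ _)).
- by rewrite leq_add2l; rewrite leq_add2l in ij; exact: (omorph_le t ij).
Qed.

(** In an indiscrete category every sequence of objects is a simplex, in particular
    the join of the images of a simplex under [f] and [g]; moving weight from one end
    of the join to the other is a homotopy from [f] to [g]. *)
Section JoinHomotopy.
Variables (A B : Type) (f g : A -> B).

Definition join_cell n (x : NI A n) (s : simplex R n) (t : I) : RI B :=
  @rcell R (NI B) (n + n.+1)
    (@tuple_simplex B (n + n.+1) (join_fun (f \o fobj x) (g \o fobj x)))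
    (join_weight s t).

Lemma join_cell_op m n (theta : {omorphism 'I_m.+1 -> 'I_n.+1}) (x : NI A n) s t :
  join_cell (sop theta x) s t = join_cell x (simplex_push theta s) t.
Proof.
rewrite /join_cell.
have -> : @tuple_simplex B (m + m.+1)
      (join_fun (f \o fobj (sop theta x)) (g \o fobj (sop theta x))) =
    sop (@mk_omorphism (m + m.+1) (n + n.+1) _ (@join_op_homo m n theta))
      (@tuple_simplex B (n + n.+1) (join_fun (f \o fobj x) (g \o fobj x))).
  apply: indiscrete_functor_eq => i /=.
  rewrite /join_op; case: (split_ordP (i : 'I_(m.+1 + m.+1))) => j ->.
    by rewrite !join_funl.
  by rewrite !join_funr.
rewrite rcell_op; congr (rcell _ _); apply: simplex_eq => i.
rewrite simplex_pushE join_weightE.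
under eq_bigr do rewrite join_weightE.
rewrite (big_mkcond (fun j => mk_omorphism _ j == i)).
rewrite (@big_split_ord _ _ _ m.+1 m.+1) /= -!big_mkcond /=.
case: (split_ordP (i : 'I_(n.+1 + n.+1))) => j ->.
  rewrite join_funl simplex_pushE mulr_sumr.
  rewrite [X in _ + X]big1 ?addr0.
    apply: eq_big => k; last by rewrite join_funl.
    rewrite join_opl; exact: (inj_eq (@lshift_inj n.+1 n.+1)).
  by move=> k; rewrite join_opr (@eq_rlshift n.+1 n.+1).
rewrite join_funr simplex_pushE mulr_sumr.
rewrite [X in X + _]big1 ?add0r.
  apply: eq_big => k; last by rewrite join_funr.
  rewrite join_opr; exact: (inj_eq (@rshift_inj n.+1 n.+1)).
by move=> k; rewrite join_opl (@eq_lrshift n.+1 n.+1).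
Qed.

Definition join_homotopy (z : RI A * I) : RI B :=
  @rlift R (NI A) _ (fun n x s => join_cell x s z.2) z.1.

Lemma join_homotopy_cell n (x : NI A n) s t :
  join_homotopy (rcell x s, t) = join_cell x s t.
Proof. by rewrite /join_homotopy rliftE // => *; exact: join_cell_op. Qed.

Lemma join_homotopy_continuous : continuous join_homotopy.
Proof.
apply: realization_prod_continuous.
- exact: unit_interval_locally_compact.
- exact: unit_interval_hausdorff.
move=> n x; under eq_fun do rewrite join_homotopy_cell.
exact: (continuousT_comp (@rcell_continuous R (NI B) (n + n.+1) _)
  (@join_weight_continuous n)).
Qed.

Lemma lshift_homo n :
  {homo @lshift n.+1 n.+1 : x y / (x <= y)%O}.
Proof. by move=> x y xy; rewrite !leEord. Qed.

Lemma rshift_homo n :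
  {homo @rshift n.+1 n.+1 : x y / (x <= y)%O}.
Proof. by move=> x y xy; rewrite !leEord /= leq_add2l. Qed.

Lemma join_homotopy0 q t : val t = 0 ->
  join_homotopy (q, t) = realize_map (indiscrete_functor f) q.
Proof.
move=> t0; have [n [x [s ->]]] := rcell_ex q.
rewrite join_homotopy_cell /realize_map realization_map_cell.
have -> : nerve_map (indiscrete_functor f) n x =
    sop (@mk_omorphism n (n + n.+1) _ (@lshift_homo n))
      (@tuple_simplex B (n + n.+1) (join_fun (f \o fobj x) (g \o fobj x))).
  by apply: indiscrete_functor_eq => i; rewrite /= join_funl.
rewrite rcell_op; congr (rcell _ _); apply: simplex_eq => i.
rewrite simplex_pushE join_weightE t0.
case: (split_ordP (i : 'I_(n.+1 + n.+1))) => j ->.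
  rewrite join_funl subr0 mul1r; rewrite (eq_bigl (pred1 j)); first by rewrite big_pred1_eq.
  by move=> k; exact: (inj_eq (@lshift_inj n.+1 n.+1)).
by rewrite join_funr mul0r big_pred0 // => k; exact: (@eq_lrshift n.+1 n.+1).
Qed.

Lemma join_homotopy1 q t : val t = 1 ->
  join_homotopy (q, t) = realize_map (indiscrete_functor g) q.
Proof.
move=> t1; have [n [x [s ->]]] := rcell_ex q.
rewrite join_homotopy_cell /realize_map realization_map_cell.
have -> : nerve_map (indiscrete_functor g) n x =
    sop (@mk_omorphism n (n + n.+1) _ (@rshift_homo n))
      (@tuple_simplex B (n + n.+1) (join_fun (f \o fobj x) (g \o fobj x))).
  by apply: indiscrete_functor_eq => i; rewrite /= join_funr.
rewrite rcell_op; congr (rcell _ _); apply: simplex_eq => i.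
rewrite simplex_pushE join_weightE t1.
case: (split_ordP (i : 'I_(n.+1 + n.+1))) => j ->.
  by rewrite join_funl subrr mul0r big_pred0 // => k; exact: (@eq_rlshift n.+1 n.+1).
rewrite join_funr mul1r; rewrite (eq_bigl (pred1 j)); first by rewrite big_pred1_eq.
by move=> k; exact: (inj_eq (@rshift_inj n.+1 n.+1)).
Qed.

End JoinHomotopy.

Lemma join_homotopy_natural (A A' B B' : Type) (f g : A -> B) (f' g' : A' -> B')
    (u : A -> A') (v : B -> B') q t :
  v \o f =1 f' \o u -> v \o g =1 g' \o u ->
  realize_map (indiscrete_functor v) (join_homotopy f g (q, t)) =
  join_homotopy f' g' (realize_map (indiscrete_functor u) q, t).
Proof.
move=> vf vg; have [n [x [s ->]]] := rcell_ex q.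
rewrite join_homotopy_cell /realize_map !realization_map_cell join_homotopy_cell.
congr (rcell _ _); apply: indiscrete_functor_eq => i /=.
rewrite /join_fun; case: fintype.split => j; [exact: vf|exact: vg].
Qed.

End Join.

Section OrbitTypes.
Variables (H K : groupType) (i : {multiplicative H -> K}).
Hypothesis i_inj : injective i.

(** Choose a representative in each right coset of [H]; the map sends an element of
    [K] to its left factor in [H]. *)
Lemma equivariant_retraction : exists r : K -> H, forall h k, r (i h * k)%g = (h * r k)%g.
Proof.
pose S k := [set (i h * k)%g | h in [set: H]].
have SE h k : S (i h * k)%g = S k.
  apply/seteqP; split=> _ [g _ <-].
    by exists (g * h)%g => //; rewrite gmulfM mulgA.
  by exists (g * h^-1)%g => //; rewrite mulgA -gmulfM mulgVK.
have Sk k : exists h, (i h * xget 1%g (S k))%g = k.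
  have [g _ gE] : S k (xget 1%g (S k)) by apply: (@xgetPex _ 1%g); exists k; exists 1%g => //; rewrite mulmorph1 mul1g.
  by exists (g^-1)%g; rewrite -gE mulgA -gmulfM mulVg mulmorph1 mul1g.
have [r rE] := choice Sk; exists r => h k.
apply: i_inj; apply: (mulIg (xget 1%g (S k))).
by rewrite -{1}(SE h k) rE gmulfM -mulgA rE.
Qed.

End OrbitTypes.

(** * The Borel construction of an orbit *)

Lemma realize_indiscrete_comp (R : realType) (A B C : Type) (g : B -> C)
    (f : A -> B) (e : realize R (indiscrete_cat A)) :
  realize_map (indiscrete_functor g) (realize_map (indiscrete_functor f) e) =
  realize_map (indiscrete_functor (g \o f)) e.
Proof.
have -> : indiscrete_functor (g \o f) =
    functor_comp (indiscrete_functor g) (indiscrete_functor f).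
  exact: indiscrete_functor_eq.
by rewrite realize_mapM.
Qed.

Lemma realize_indiscrete_id (R : realType) (A : Type)
    (e : realize R (indiscrete_cat A)) :
  realize_map (indiscrete_functor id) e = e.
Proof.
have -> : indiscrete_functor id = functor_id (indiscrete_cat A).
  exact: indiscrete_functor_eq.
exact: realize_map1.
Qed.

Lemma realize_indiscrete_square (R : realType) (A B B' C : Type) (g : B -> C)
    (f : A -> B) (g' : B' -> C) (f' : A -> B') (e : realize R (indiscrete_cat A)) :
  g \o f =1 g' \o f' ->
  realize_map (indiscrete_functor g) (realize_map (indiscrete_functor f) e) =
  realize_map (indiscrete_functor g') (realize_map (indiscrete_functor f') e).
Proof. by move=> /funext E; rewrite !realize_indiscrete_comp E. Qed.

Section OrbitType.
Context (R : realType) d (Q : porderType d) (G : complex_of_groups Q).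
Context (K : groupType).
Variables (c : cocone G K) (q : Q).
Hypothesis c_inj : injective (c q).
Local Notation I := (@unit_interval R).
Local Notation H := (G q).
Local Notation EK := (EG R K).
Local Notation EH := (EG R H).
Local Notation CK := (realizeK R (coset_cat c q)).
Local Notation base := (to_coset c 1%g q).
Local Notation bvertex := (@borel_vertex R d Q G K c).

Definition EG_incl : EH -> EK := realize_map (indiscrete_functor (c q)).

Lemma EG_incl_act h e : EG_incl (kact h e) = kact (c q h) (EG_incl e).
Proof. by apply: realize_indiscrete_square => g /=; rewrite gmulfM. Qed.

Lemma base_act h : coset_translate (c q h) base = base.
Proof.
rewrite coset_translateE; apply/to_coset_eqP; exists h^-1%g => //.
by rewrite !mulg1 -[RHS]mulg1 -(mulmorph1 (c q)) -(mulgV h) gmulfM mulKg.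
Qed.

Lemma base_vertex_act h (e : EK) : bvertex (kact (c q h) e) base = bvertex e base.
Proof. by rewrite -{1}(base_act h) borel_vertex_act. Qed.

(** The pairs [(e, A)] and [(centre e A, base)] have the same orbit; this reduces
    [EK *_K K/G(q)] to [EK / G(q)].  The representative of [A] is defined up to
    [G(q)] only, hence [centre_act]. *)
Definition centre (e : EK) (A : cosets c q) : EK := kact (coset_rep A)^-1%g e.

Lemma centre_act k e A :
  exists h, centre (kact k e) (coset_translate k A) = kact (c q h) (centre e A).
Proof.
have : to_coset c (coset_rep (coset_translate k A)) q =
    to_coset c (k * coset_rep A)%g q.
  by rewrite coset_repK -coset_translateE coset_repK.
move=> /to_coset_eqP [h _ hE]; exists h.
by rewrite /centre -!kactM hE mulgA mulgK.
Qed.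

Lemma component_translate k (y : CK) :
  component (kact k y) = coset_translate k (component y) :> cosets c q.
Proof. exact: component_map. Qed.

Lemma bvertex_centre e A : bvertex (centre e A) base = bvertex e A.
Proof.
rewrite -(borel_vertex_act (coset_rep A)) coset_translateE mulg1 coset_repK.
by rewrite /centre kactKV.
Qed.

Lemma centre_continuous A : continuous (centre^~ A).
Proof. exact: kact_continuous. Qed.

Section Retraction.
Variable r : K -> H.
Hypothesis rE : forall h k, r (c q h * k)%g = (h * r k)%g.

Definition EG_retr : EK -> EH := realize_map (indiscrete_functor r).

Lemma EG_retr_act h e : EG_retr (kact (c q h) e) = kact h (EG_retr e).
Proof. by apply: realize_indiscrete_square => k /=; rewrite rE. Qed.

Definition EK_homotopy : EK * I -> EK := @join_homotopy R K K (c q \o r) id.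
Definition EH_homotopy : EH * I -> EH := @join_homotopy R H H (r \o c q) id.

Lemma EK_homotopy_act h (e : EK) t :
  EK_homotopy (kact (c q h) e, t) = kact (c q h) (EK_homotopy (e, t)).
Proof.
apply/esym; apply: join_homotopy_natural => k //=.
by rewrite rE gmulfM.
Qed.

Lemma EH_homotopy_act h (e : EH) t :
  EH_homotopy (kact h e, t) = kact h (EH_homotopy (e, t)).
Proof.
apply/esym; apply: join_homotopy_natural => k //=.
by rewrite gmulfM rE.
Qed.

Definition to_BG : borel R CK -> BG R H :=
  ilift (fun p : prod_Kspace EK CK =>
    @orbit_pi H EH (EG_retr (centre p.1 (component p.2)))).

Lemma to_BGE e y : to_BG (@orbit_pi K (prod_Kspace EK CK) (e, y)) =
  @orbit_pi H EH (EG_retr (centre e (component y))).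
Proof.
rewrite /to_BG /orbit_pi iliftE // => {e y} -[e y] _ [k ->].
suff : @orbit_pi H EH (EG_retr (centre e (component y))) =
  @orbit_pi H EH (EG_retr (centre (kact k e) (component (@kact K CK k y)))) by [].
have [h hE] := centre_act k e (component y).
by rewrite component_translate hE EG_retr_act orbit_pi_act.
Qed.

Lemma to_BG_continuous : continuous to_BG.
Proof.
apply: identify_continuous.
rewrite [W in continuous W](_ : _ = fun p : prod_Kspace EK CK =>
    @orbit_pi H EH (EG_retr (centre p.1 (component p.2)))); last first.
  by apply/funext => -[e y]; exact: to_BGE.
apply: (component_case_continuous (u := snd) (g := fun (p : prod_Kspace EK CK) A =>
  @orbit_pi H EH (EG_retr (centre p.1 A)))); first exact: snd_continuous.
move=> A; have cr : continuous EG_retr by exact: realize_map_continuous.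
exact: (continuousT_comp (@orbit_pi_continuous H EH)
  (continuousT_comp cr (continuousT_comp (@centre_continuous A) (@fst_continuous _ _)))).
Qed.

Definition of_BG : BG R H -> borel R CK :=
  ilift (fun e : EH => bvertex (EG_incl e) base).

Lemma of_BGE e : of_BG (@orbit_pi H EH e) = bvertex (EG_incl e) base.
Proof.
rewrite /of_BG /orbit_pi iliftE // => {}e _ [h ->].
by rewrite EG_incl_act base_vertex_act.
Qed.

Lemma of_BG_continuous : continuous of_BG.
Proof.
apply: identify_continuous.
rewrite [W in continuous W](_ : _ = fun e : EH => bvertex (EG_incl e) base).
  have ci : continuous EG_incl by exact: realize_map_continuous.
  exact: (continuousT_comp (@borel_vertex_continuous R _ _ _ _ c q base) ci).
by apply/funext => e; exact: of_BGE.
Qed.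

(** [EK_homotopy] is equivariant for [G(q)] only, so it acts on the Borel construction
    after recentring at the base coset. *)
Definition borel_homotopy (z : borel R CK * I) : borel R CK :=
  ilift (fun p : prod_Kspace EK CK =>
    bvertex (EK_homotopy (centre p.1 (component p.2), z.2)) base) z.1.

Lemma borel_homotopyE e y t :
  borel_homotopy (@orbit_pi K (prod_Kspace EK CK) (e, y), t) =
  bvertex (EK_homotopy (centre e (component y), t)) base.
Proof.
have inv (p p' : prod_Kspace EK CK) : orbit_rel p p' ->
    bvertex (EK_homotopy (centre p.1 (component p.2), t)) base =
    bvertex (EK_homotopy (centre p'.1 (component p'.2), t)) base; last first.
  exact: (iliftE inv (e, y)).
case: p => {}e {}y [k ->].
suff : bvertex (EK_homotopy (centre e (component y), t)) base =
  bvertex (EK_homotopy (centre (kact k e) (component (@kact K CK k y)), t)) base.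
  by [].
have [h hE] := centre_act k e (component y).
by rewrite component_translate hE EK_homotopy_act base_vertex_act.
Qed.

Lemma borel_homotopy_continuous : continuous borel_homotopy.
Proof.
apply: orbit_prod_continuous.
rewrite [W in continuous W](_ : _ = fun z : prod_Kspace EK CK * I =>
    bvertex (EK_homotopy (centre z.1.1 (component z.1.2), z.2)) base); last first.
  by apply/funext => -[[e y] t]; exact: borel_homotopyE.
have c1 : continuous (fun z : prod_Kspace EK CK * I => z.1.1).
  exact: (continuousT_comp (@fst_continuous _ _) (@fst_continuous _ _)).
have c2 : continuous (fun z : prod_Kspace EK CK * I => z.1.2).
  exact: (continuousT_comp (@snd_continuous _ _) (@fst_continuous _ _)).
apply: (component_case_continuous (u := fun z : prod_Kspace EK CK * I => z.1.2)
  (g := fun z A => bvertex (EK_homotopy (centre z.1.1 A, z.2)) base) c2) => A.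
have c3 := continuousT_pair (continuousT_comp (@centre_continuous A) c1)
  (@snd_continuous _ I).
exact: (continuousT_comp (@borel_vertex_continuous R _ _ _ _ c q base)
  (continuousT_comp (@join_homotopy_continuous R K K (c q \o r) id) c3)).
Qed.

Definition BG_homotopy (z : BG R H * I) : BG R H :=
  ilift (fun e : EH => @orbit_pi H EH (EH_homotopy (e, z.2))) z.1.

Lemma BG_homotopyE e t :
  BG_homotopy (@orbit_pi H EH e, t) = @orbit_pi H EH (EH_homotopy (e, t)).
Proof.
have inv (e1 e2 : EH) : orbit_rel e1 e2 ->
    @orbit_pi H EH (EH_homotopy (e1, t)) = @orbit_pi H EH (EH_homotopy (e2, t)).
  by move=> [h ->]; rewrite EH_homotopy_act orbit_pi_act.
exact: (iliftE inv e).
Qed.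

Lemma BG_homotopy_continuous : continuous BG_homotopy.
Proof.
apply: orbit_prod_continuous.
rewrite [W in continuous W](_ : _ = fun z : EH * I =>
    @orbit_pi H EH (EH_homotopy z)); last first.
  by apply/funext => -[e t]; exact: BG_homotopyE.
exact: (continuousT_comp (@orbit_pi_continuous H EH)
  (@join_homotopy_continuous R H H (r \o c q) id)).
Qed.

Lemma of_to_BG : homotopic R (of_BG \o to_BG) id.
Proof.
exists borel_homotopy; split; first exact: borel_homotopy_continuous.
- move=> z t t0; have [[e y] <-] := ipi_surj z.
  rewrite -/(@orbit_pi K (prod_Kspace EK CK) (e, y)) borel_homotopyE.
  rewrite /comp to_BGE of_BGE /EK_homotopy join_homotopy0 //.
  by rewrite -realize_indiscrete_comp.
- move=> z t t1; have [[e y] <-] := ipi_surj z.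
  rewrite -/(@orbit_pi K (prod_Kspace EK CK) (e, y)) borel_homotopyE.
  rewrite /EK_homotopy join_homotopy1 // realize_indiscrete_id bvertex_centre.
  by rewrite /borel_vertex vertex_component.
Qed.

Lemma to_of_BG : homotopic R (to_BG \o of_BG) id.
Proof.
exists BG_homotopy; split; first exact: BG_homotopy_continuous.
- move=> z t t0; have [e <-] := ipi_surj z.
  rewrite -/(@orbit_pi H EH e) BG_homotopyE /comp of_BGE to_BGE vertexK.
  have [h _ hE] : range (c q) (coset_rep base)^-1%g.
    by rewrite -[_^-1%g]mulg1; apply/to_coset_eqP; exact: coset_repK.
  rewrite /centre -hE EG_retr_act orbit_pi_act.
  rewrite /EH_homotopy join_homotopy0 //.
  by rewrite -realize_indiscrete_comp.
- move=> z t t1; have [e <-] := ipi_surj z.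
  rewrite -/(@orbit_pi H EH e) BG_homotopyE.
  by rewrite /EH_homotopy join_homotopy1 // realize_indiscrete_id.
Qed.

End Retraction.

Lemma borel_coset_BG : homotopy_equivalent R (borel R CK) (BG R H).
Proof.
have [r rE] := equivariant_retraction c_inj.
exists (to_BG r), of_BG; split.
- exact: to_BG_continuous.
- exact: of_BG_continuous.
- exact: of_to_BG.
- exact: to_of_BG.
Qed.

End OrbitType.

Theorem theorem2p1 (R : realType) (d : Order.disp_t) (Q : porderType d)
    (G : complex_of_groups Q) (Ghat K : groupType) (iota : cocone G Ghat)
    (phi : {multiplicative Ghat -> K}) :
  connected_poset Q ->
  is_colimit iota ->
  (forall q : Q, injective (phi \o iota q)) ->
  let c := cocone_comp phi iota in
  let P := realizeK R (coset_Kcat c) in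
  exists F : Kcat_diagram Q K,
    [/\ homotopy_equivalent R (realize R (poset_cat (coset_poset c)))
          (hocolim R (realize_diagram R F)),
        forall q : Q, homotopy_equivalent R (realize R (F q))
          (discrete_topology (cosets c q)),
        forall e : EG R K, fibration_sequence R
          (borel_incl (X := P) e) (@borel_proj R K P) (orbit_pi e),
        homotopy_equivalent R (borel R P) (hocolim R (borel_diagram R F)) &
        forall q : Q, homotopy_equivalent R (borel R (realizeK R (F q)))
          (BG R (G q))].
Proof.
move=> _ _ phi_inj c P; exists (coset_diagram c); split.
- exact: coset_poset_hocolim.
- move=> q; exact: realize_discrete_homotopy_equivalent.
- move=> e; apply: associated_bundle_fibration_sequence.
  exact: EG_properly_discontinuous.
- exact: borel_hocolim.
- move=> q; apply: borel_coset_BG; exact: phi_inj.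
Qed.
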